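(* Let $\mathbf{A}\in\mathbb{R}^{n\times d}$, $\mathbf{B}\in\mathbb{R}^{n\times d_B}$ and $\mathbf{C}\in\mathbb{R}^{n_C\times d}$. For any two nonnegative integers $k\le \mathrm{rank}(\mathbf{B})$ and $r\le\mathrm{rank}(\mathbf{C})$, there exist a $k$-subset $\widehat S\subset[d_B]$ and an $r$-subset $\widehat R\subset[n_C]$ (which can be selected iteratively, one index at a time) such that $\mathrm{rank}(\mathbf{B}_{:,\widehat S})=k$, $\mathrm{rank}(\mathbf{C}_{\widehat R,:})=r$ and $$\big\|(\mathbf{I}_n-\mathbf{B}_{:,\widehat S}\mathbf{B}_{:,\widehat S}^{\dagger})\,\mathbf{A}\,(\mathbf{I}_d-\mathbf{C}_{\widehat R,:}^{\dagger}\mathbf{C}_{\widehat R,:})\big\|_2^2\le \mathrm{maxroot}\ P_{k,r}(x;\mathbf{A},\mathbf{B},\mathbf{C}).$$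
   Context: $[n]=\{1,\dots,n\}$. For a matrix $\mathbf{M}$, $\mathbf{M}_{R,S}$ is the submatrix with rows indexed by $R$ and columns by $S$; $\mathbf{M}_{:,S}$ keeps all rows, $\mathbf{M}_{R,:}$ keeps all columns; $\mathbf{M}^\dagger$ is the Moore–Penrose pseudoinverse and $\mathbf{M}_{R,S}^\dagger:=(\mathbf{M}_{R,S})^\dagger$. Conventions: the determinant of a $0\times 0$ matrix is $1$, and $\mathbf{M}_{:,\emptyset}\mathbf{M}_{:,\emptyset}^\dagger$ and $\mathbf{M}_{\emptyset,:}^\dagger\mathbf{M}_{\emptyset,:}$ are zero matrices. For $S\subset[d_B]$, $R\subset[n_C]$ set $\mathbf{Q}_S=\mathbf{I}_n-\mathbf{B}_{:,S}\mathbf{B}_{:,S}^\dagger$, $\mathbf{P}_R=\mathbf{I}_d-\mathbf{C}_{R,:}^\dagger\mathbf{C}_{R,:}$ and $p_{S,R}(x;\mathbf{A},\mathbf{B},\mathbf{C})=\det[x\mathbf{I}_d-(\mathbf{Q}_S\mathbf{A}\mathbf{P}_R)^{\rm T}(\mathbf{Q}_S\mathbf{A}\mathbf{P}_R)]$. Define $$P_{k,r}(x;\mathbf{A},\mathbf{B},\mathbf{C})=\sum_{R\subset[n_C],|R|=r}\ \sum_{S\subset[d_B],|S|=k}\det[\mathbf{C}_{R,:}(\mathbf{C}_{R,:})^{\rm T}]\det[(\mathbf{B}_{:,S})^{\rm T}\mathbf{B}_{:,S}]\,p_{S,R}(x;\mathbf{A},\mathbf{B},\mathbf{C}).$$ This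 polynomial is real-rooted for $0\le k\le\mathrm{rank}(\mathbf{B})$, $0\le r\le\mathrm{rank}(\mathbf{C})$, and $\mathrm{maxroot}$ denotes its largest root. $\|\cdot\|_2$ is the spectral norm. *)

(* Defs.v *)
From HB Require Import structures.
From mathcomp Require Import all_boot all_order all_algebra.
From mathcomp Require Import boolp classical_sets reals.
From Stdlib Require Import ClassicalEpsilon.
Set Implicit Arguments. Unset Strict Implicit. Unset Printing Implicit Defensive.
Import Order.TTheory GRing.Theory Num.Theory.
Local Open Scope ring_scope.

Section Defs.
Variable R : realType.

Definition penrose (m n : nat) (M : 'M[R]_(m, n)) (X : 'M[R]_(n, m)) : Prop :=
  [/\ M *m X *m M = M, X *m M *m X = X, (M *m X)^T = M *m X & (X *m M)^T = X *m M].

(* Moore--Penrose pseudoinverse M^dagger (the unique X satisfying the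
   Penrose conditions; chosen by classical epsilon). *)
Definition pinv (m n : nat) (M : 'M[R]_(m, n)) : 'M[R]_(n, m) :=
  epsilon (inhabits 0) (penrose M).

Definition colS (n dB : nat) (B : 'M[R]_(n, dB)) (S : {set 'I_dB}) :
  'M[R]_(n, #|S|) := colsub (@enum_val _ (mem S)) B.

Definition rowS (nC d : nat) (C : 'M[R]_(nC, d)) (Rs : {set 'I_nC}) :
  'M[R]_(#|Rs|, d) := rowsub (@enum_val _ (mem Rs)) C.

Definition Qproj (n dB : nat) (B : 'M[R]_(n, dB)) (S : {set 'I_dB}) : 'M[R]_n :=
  1%:M - colS B S *m pinv (colS B S).

Definition Pproj (nC d : nat) (C : 'M[R]_(nC, d)) (Rs : {set 'I_nC}) : 'M[R]_d :=
  1%:M - pinv (rowS C Rs) *m rowS C Rs.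

Definition pSR (n d dB nC : nat) (A : 'M[R]_(n, d)) (B : 'M[R]_(n, dB))
  (C : 'M[R]_(nC, d)) (S : {set 'I_dB}) (Rs : {set 'I_nC}) : {poly R} :=
  let M := Qproj B S *m A *m Pproj C Rs in char_poly (M^T *m M).

Definition Pkr (n d dB nC : nat) (k r : nat) (A : 'M[R]_(n, d))
  (B : 'M[R]_(n, dB)) (C : 'M[R]_(nC, d)) : {poly R} :=
  \sum_(Rs : {set 'I_nC} | #|Rs| == r) \sum_(S : {set 'I_dB} | #|S| == k)
     (\det (rowS C Rs *m (rowS C Rs)^T) * \det ((colS B S)^T *m colS B S))
       *: pSR A B C S Rs.

Definition maxroot (p : {poly R}) : R := sup [set x : R | root p x].

Definition enorm (m : nat) (x : 'cV[R]_m) : R := Num.sqrt (\sum_i x i 0 ^+ 2).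

Definition spnorm (m n : nat) (M : 'M[R]_(m, n)) : R :=
  sup [set enorm (M *m x) | x in [set x : 'cV[R]_n | enorm x = 1]].

End Defs.

(* Main.v *)
Require Import Defs.
From HB Require Import structures.
From mathcomp Require Import all_boot all_order all_algebra.
From mathcomp Require Import boolp reals.
From mathcomp Require Import complex polyrcf ring lra.
Import Order.TTheory GRing.Theory Num.Theory.
Local Open Scope ring_scope.

(** Put [Z = [[0, A], [A^T, 0]]] and let the columns [w_i] of [W = diag(B, C^T)]
carry two colours.  The multi-affine polynomial [det (y - Z + sum_i u_i w_i w_i^T)]
has as coefficient of [prod_(i in T) u_i] a bordered determinant [a_T(y)], and for
[T = (S, R)] one gets [y^(k+r+d) a_T(y) = det(C_R C_R^T) det(B_S^T B_S) y^n p_(S,R)(y^2)].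
Hence [P_(k,r)(y^2)] is, up to powers of [y], the sum of the [a_T] over all [T] with
[k] columns of the first colour and [r] of the second.

Let [f_T0] be the part of this sum over [T] containing [T0].  If one column of some
colour is dropped from the prescribed numbers, the corresponding sum [g] satisfies
[g + w f_(T0+i) = g(Z - w w_i w_i^T)] for every [i] of that colour.  An induction over
matrices whose imaginary part is positive definite shows that such sums do not vanish
for [Im y > 0] and [Im w >= 0]; since [Im (f_(T0+i) / g) < 0], sums over [i] do not
vanish either, which feeds the induction.  Therefore [g] is real-rooted and every
[f_(T0+i)] is a nonnegative combination of the [g / (y - l_j)], [l_j] the roots of [g].
The second largest root of [g] then separates the largest roots of all [f_(T0+i)] from
the others, so that some [f_(T0+i)] has no root beyond the largest root of
[f_T0 = const * sum_i f_(T0+i)].  Adding columns greedily gives [T]. *)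

Set Implicit Arguments. Unset Strict Implicit. Unset Printing Implicit Defensive.

(** * Bordered determinants *)

Section BorderedDeterminants.
Variable F : comNzRingType.

(** Multiplying [[[1, -X], [Y, 1]]] by the same unipotent block matrix from the right and from the
    left gives two block triangular matrices with these determinants. *)
Lemma det_1DmulC m n (X : 'M[F]_(m, n)) (Y : 'M[F]_(n, m)) :
  \det (1%:M + X *m Y) = \det (1%:M + Y *m X).
Proof.
have E1 : \det (block_mx 1%:M (- X) Y 1%:M *m block_mx 1%:M X 0 1%:M)
          = \det (1%:M + Y *m X).
  rewrite mulmx_block !mulmx1 !mul1mx !mulmx0 !addr0 subrr det_lblock det1 mul1r.
  by rewrite addrC.
have E2 : \det (block_mx 1%:M X 0 1%:M *m block_mx 1%:M (- X) Y 1%:M)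
          = \det (1%:M + X *m Y).
  rewrite mulmx_block !mulmx1 !mul1mx !mul0mx !add0r addNr det_lblock det1 mulr1 //.
by rewrite -E1 -E2 !det_mulmx mulrC.
Qed.

Section Masked.
Variables N m : nat.
Implicit Types (M : 'M[F]_N) (W : 'M[F]_(N, m)) (T : {set 'I_m}).

Definition maskmx T : 'M[F]_m := diag_mx (\row_j (j \in T)%:R).

(* Its determinant is that of [[M, W_T], [- W_T^T, 0]]; the identity block outside [T]
   only keeps the size independent of [T]. *)
Definition border_mx M W T : 'M[F]_(N + m) :=
  block_mx M (W *m maskmx T) (- (maskmx T *m W^T)) (1%:M - maskmx T).

Lemma mask_idem T : maskmx T *m maskmx T = maskmx T.
Proof.
rewrite /maskmx mulmx_diag; congr diag_mx; apply/rowP=> j; rewrite !mxE.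
by case: (_ \in _); rewrite ?mulr1 ?mulr0.
Qed.

Lemma tr_mask T : (maskmx T)^T = maskmx T.
Proof. exact: tr_diag_mx. Qed.

Lemma mask_in T i : i \in T -> maskmx T *m delta_mx i 0 = delta_mx i 0 :> 'cV_m.
Proof.
move=> iT; rewrite mul_diag_mx; apply/matrixP=> a b; rewrite !mxE.
by case: eqP => [->|_]; rewrite ?iT ?mul1r ?mulr0.
Qed.

Lemma mask_notin T i : i \notin T -> maskmx T *m delta_mx i 0 = 0 :> 'cV_m.
Proof.
move=> iT; rewrite mul_diag_mx; apply/matrixP=> a b; rewrite !mxE.
by case: eqP => [->|_]; rewrite ?(negbTE iT) ?mul0r ?mulr0.
Qed.

Lemma mask_setU1 T i : i \notin T ->
  maskmx (i |: T) = maskmx T + delta_mx i 0 *m (delta_mx i 0 : 'cV_m)^T.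
Proof.
move=> iT; rewrite trmx_delta mul_delta_mx; apply/matrixP=> a b; rewrite !mxE !inE.
case: (a =P b) => [<-|nab]; last first.
  rewrite !mulr0n add0r; case: (a =P i) => [ai|//]; case: (b =P i) => [bi|//].
  by case: nab; rewrite ai bi.
rewrite !mulr1n; case: (a =P i) => [->|_]; last by rewrite addr0.
by rewrite (negbTE iT) add0r.
Qed.

Lemma delta_normE (i : 'I_m) :
  (delta_mx i 0 : 'cV[F]_m)^T *m delta_mx i 0 = 1%:M.
Proof. by rewrite trmx_delta mul_delta_mx; apply/matrixP=> a b; rewrite !ord1 !mxE. Qed.

(** Row [i] of the lower blocks is [(- w^T, 0)], and multiples of it absorb the rank-one term. This
    is why each [u_i] enters to degree one. *)
Lemma det_border_in M W T i (c : F) : i \in T ->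
  \det (border_mx (M + c *: (col i W *m (col i W)^T)) W T) = \det (border_mx M W T).
Proof.
move=> iT; set w := col i W; pose e : 'cV[F]_m := delta_mx i 0.
have wE : w = W *m e by rewrite /w colE.
have De : maskmx T *m e = e by apply: mask_in.
have eD : e^T *m maskmx T = e^T by rewrite -{2}De trmx_mul tr_mask.
have := det_mulmx (block_mx 1%:M (- (c *: (w *m e^T))) 0 1%:M) (border_mx M W T).
rewrite det_ublock !det1 !mul1r => <-; congr (\det _).
rewrite /border_mx mulmx_block !mul1mx !mul0mx !add0r; congr block_mx.
- by rewrite mulNmx mulmxN opprK -scalemxAl -mulmxA (mulmxA e^T) eD -trmx_mul -wE.
- by rewrite mulNmx -scalemxAl -mulmxA mulmxBr mulmx1 eD subrr mulmx0 scaler0 subr0.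
Qed.

Lemma det_border_notin M W T i (c : F) : i \notin T ->
  \det (border_mx (M + c *: (col i W *m (col i W)^T)) W T) =
  \det (border_mx M W T) + c * \det (border_mx M W (i |: T)).
Proof.
move=> iT; set w := col i W; pose e : 'cV[F]_m := delta_mx i 0.
have wE : w = W *m e by rewrite /w colE.
have De : maskmx T *m e = 0 by apply: mask_notin.
have eD : e^T *m maskmx T = 0 by rewrite -(trmxK (maskmx T)) -trmx_mul tr_mask De trmx0.
have ee : e^T *m e = 1%:M by apply: delta_normE.
(* [c'] occurs only in row [i] of the lower blocks, which reads [(- c' w^T, e^T)]. Eliminating
   [w e^T] gives the bordered matrix of [M + c' w w^T]; linearity in that row splits the determinant
   into those of [X 0] and of the matrix for [i |: T]. *)
pose X c' := block_mx M (W *m maskmx T + w *m e^T)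
  (- (maskmx T *m W^T) - c' *: (e *m w^T)) (1%:M - maskmx T).
have XE c' : \det (X c') = \det (border_mx (M + c' *: (w *m w^T)) W T).
  have := det_mulmx (block_mx 1%:M (- (w *m e^T)) 0 1%:M) (X c').
  rewrite det_ublock !det1 !mul1r => <-.
  have := det_mulmx (block_mx 1%:M (- (w *m e^T)) 0 1%:M *m X c')
      (block_mx 1%:M 0 (c' *: (e *m w^T)) 1%:M).
  rewrite det_lblock !det1 !mulr1 => <-; congr (\det _).
  rewrite /border_mx /X !mulmx_block !mul1mx !mul0mx !mulmx1 !mulmx0 !add0r.
  have E1 : W *m maskmx T + w *m e^T + - (w *m e^T) *m (1%:M - maskmx T) = W *m maskmx T.
    by rewrite mulNmx mulmxBr mulmx1 -(mulmxA w) eD mulmx0 subr0 addrK.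
  rewrite E1; congr block_mx.
  - rewrite mulNmx mulmxBr mulmxN -(mulmxA w) (mulmxA e^T) eD mul0mx mulmx0.
    rewrite oppr0 add0r opprK -scalemxAr -(mulmxA w) (mulmxA e^T) ee mul1mx.
    by rewrite -scalemxAr -(mulmxA W) (mulmxA (maskmx T)) De mul0mx mulmx0 scaler0 addr0.
  - rewrite -scalemxAr mulmxA mulmxBl mul1mx De subr0.
    by rewrite subrK.
rewrite -XE.
have X0 : \det (X 0) = \det (border_mx M W T) by rewrite XE scale0r addr0.
rewrite -X0 -[\det (X 0)]mul1r.
have rowE' (A1 : 'M[F]_(N, N)) A2 A3 A4 :
    row (rshift N i) (block_mx A1 A2 A3 A4 : 'M[F]_(N + m))
    = e^T *m row_mx A3 A4.
  by rewrite /block_mx rowKd rowE /e trmx_delta.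
have row'_block (A1 : 'M[F]_(N, N)) A2 A3 A4 A3' A4' :
    (forall j, j != i -> row j A3 = row j A3') ->
    (forall j, j != i -> row j A4 = row j A4') ->
    row' (rshift N i) (block_mx A1 A2 A3 A4 : 'M[F]_(N + m)) =
    row' (rshift N i) (block_mx A1 A2 A3' A4' : 'M[F]_(N + m)).
  move=> e3 e4; apply/row_matrixP=> a; apply/rowP=> b; rewrite !mxE.
  case: (splitP (lift (rshift N i) a)) => j Ej; rewrite !mxE //.
  have ji : j != i.
    apply: contraNneq (neq_lift (rshift N i) a) => ji.
    by apply/eqP/ord_inj; rewrite Ej ji.
  by case: splitP => l _; [have/rowP/(_ l) := e3 j ji | have/rowP/(_ l) := e4 j ji];
    rewrite !mxE.
have rowe j : j != i -> delta_mx 0 j *m e = 0 :> 'M_1.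
  by move=> ji; rewrite mul_delta_mx_0.
apply: (@determinant_multilinear _ _ _ _ _ (rshift N i)).
- rewrite /X /border_mx (mask_setU1 iT) -/e !rowE' !mul_mx_row scale1r scale_row_mx.
  rewrite add_row_mx; congr row_mx.
    rewrite mulmxDl !mulmxBr scale0r mulmx0 subr0 !mulmxN mulmxDr !mulmxA !eD.
    rewrite !mul0mx !oppr0 !add0r -mulmxA -trmx_mul -wE -scalemxAr mulmxA ee.
    by rewrite mul1mx scalerN.
  by rewrite !mulmxBr !mulmxDr mulmx1 eD mulmxA ee mul1mx add0r subrr scaler0 addr0.
- apply: row'_block => [j ji|//]; rewrite scale0r subr0.
  by rewrite !rowE mulmxBr -scalemxAr mulmxA rowe // mul0mx scaler0 subr0.
- rewrite /border_mx (mask_setU1 iT) mulmxDr mulmxA -/e -wE.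
  apply: row'_block => j ji.
    rewrite mulmxDl -mulmxA -trmx_mul -wE !rowE !mulmxBr !mulmxN mulmxDr.
    by rewrite -scalemxAr !(mulmxA _ e) rowe // !mul0mx scaler0 addr0 subr0.
  by rewrite opprD addrA !rowE mulmxBr (mulmxA _ e) rowe // mul0mx subr0.
Qed.
End Masked.

Definition selmx m (T : {set 'I_m}) : 'M[F]_(m, #|T|) :=
  \matrix_(i, j) (i == enum_val j)%:R.

Lemma selmx_orth m (T : {set 'I_m}) : (selmx T)^T *m selmx T = 1%:M.
Proof.
apply/matrixP => i j; rewrite !mxE.
rewrite (bigD1 (enum_val i)) //= big1 ?addr0.
  by rewrite !mxE eqxx mul1r (inj_eq enum_val_inj).
by move=> k ki; rewrite !mxE (negbTE ki) mul0r.
Qed.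

Lemma selmx_mask m (T : {set 'I_m}) : selmx T *m (selmx T)^T = maskmx T.
Proof.
apply/matrixP => i j; rewrite !mxE.
have [iT|iT] := boolP (i \in T); last first.
  rewrite mul0rn big1 // => k _; rewrite !mxE; case: eqP => [ik|]; rewrite ?mul0r //.
  by move: iT; rewrite ik enum_valP.
rewrite (bigD1 (enum_rank_in iT i)) //= big1 ?addr0.
  by rewrite !mxE enum_rankK_in // eqxx mul1r eq_sym.
move=> k ki; rewrite !mxE; case: eqP => [ik|]; rewrite ?mul0r //.
by case/eqP: ki; apply: enum_val_inj; rewrite enum_rankK_in.
Qed.

(** The bordered matrix is [1 + G (X - 1) G^T] with [G^T G = 1], so [det_1DmulC] compresses it. [E]
    stays abstract because both the enumeration of [T] and a block diagonal selection will serve. *)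
Lemma det_border_select N m t (M : 'M[F]_N) (W : 'M[F]_(N, m)) T
    (E : 'M[F]_(m, t)) : E^T *m E = 1%:M -> E *m E^T = maskmx T ->
  \det (border_mx M W T) = \det (block_mx M (W *m E) (- (W *m E)^T) 0).
Proof.
move=> EE1 EET; pose G : 'M[F]_(N + m, N + t) := block_mx 1%:M 0 0 E.
set X := block_mx M _ _ _.
have GG : G^T *m G = 1%:M.
  rewrite tr_block_mx mulmx_block !trmx0 !trmx1 !mulmx1 !mulmx0 !mul0mx !addr0 !add0r.
  by rewrite EE1 -scalar_mx_block.
have -> : border_mx M W T = 1%:M + G *m ((X - 1%:M) *m G^T).
  rewrite mulmxBl mulmxBr mul1mx /G tr_block_mx !trmx0 !trmx1 !mulmx_block.
  rewrite ?(mulmx1, mulmx0, mul0mx, mul1mx, addr0, add0r).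
  rewrite EET (scalar_mx_block N m) opp_block_mx !add_block_mx !oppr0 !addr0 !add0r.
  rewrite addrCA subrr addr0 -mulmxA EET mulmxN trmx_mul mulmxA EET.
  by [].
rewrite det_1DmulC -mulmxA GG mulmx1 addrC subrK //.
Qed.

(** Block elimination replaces [Z] by its compression [Q Z Q]. As [Q V = 0], the corner then acts on
    [V] as multiplication by [y], and a further elimination leaves the Gram matrix [V^T V]. The
    factor [y ^+ t] avoids division by [y]. *)
Lemma det_border_proj N t (y : F) (Z Q : 'M[F]_N) (V : 'M[F]_(N, t)) (X : 'M[F]_(t, N)) :
  Q = 1%:M - V *m X -> (V *m X)^T = V *m X -> V *m X *m V = V ->
  \det (block_mx (y%:M - Z) V (- V^T) 0) * y ^+ t =
  \det (V^T *m V) * \det (y%:M - Q *m Z *m Q).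
Proof.
move=> QE symP PV; set P := V *m X.
have QV : Q *m V = 0 by rewrite QE mulmxBl mul1mx PV subrr.
have PE : P = X^T *m V^T by rewrite -trmx_mul symP.
have QQ : Q *m Q = Q by rewrite {2}QE mulmxBr mulmx1 mulmxA QV mul0mx subr0.
pose M := y%:M - Z.
(* [L] turns the corner into [M Q]; [L'] subtracts [P M Q] and adds [y P], leaving
   [Q M Q + y P = y - Q Z Q]. *)
pose L := block_mx 1%:M (M *m X^T) 0 1%:M : 'M[F]_(N + t).
pose L' := block_mx 1%:M 0 (y *: X - X *m M *m Q) 1%:M : 'M[F]_(N + t).
have E1 : L *m block_mx M V (- V^T) 0 *m L' =
    block_mx (y%:M - Q *m Z *m Q) V (- V^T) 0.
  rewrite /L /L' !mulmx_block ?(mulmx1, mulmx0, mul0mx, mul1mx, addr0, add0r).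
  congr block_mx.
  have -> : M + M *m X^T *m - V^T = M *m Q.
    by rewrite mulmxN -mulmxA -PE QE mulmxBr mulmx1.
  rewrite mulmxBr -scalemxAr !mulmxA -/P addrCA addrC -(mulmxA P M Q).
  have -> : M *m Q - P *m (M *m Q) = Q *m (M *m Q) by rewrite -{1}[M *m Q]mul1mx -mulmxBl -QE.
  rewrite mulmxA /M mulmxBr mulmxBl mul_mx_scalar -scalemxAl QQ addrAC -scalerDr.
  by rewrite {1}QE subrK scalemx1.
have DE : \det (block_mx M V (- V^T) 0) = \det (block_mx (y%:M - Q *m Z *m Q) V (- V^T) 0).
  by rewrite -E1 !det_mulmx det_ublock det_lblock !det1 !mulr1 !mul1r.
have := det_mulmx (block_mx (y%:M - Q *m Z *m Q) V (- V^T) 0) (block_mx 1%:M (- V) 0 y%:M).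
rewrite det_ublock det1 mul1r det_scalar -DE => <-.
rewrite mulmx_block ?(mulmx1, mulmx0, mul0mx, addr0, add0r).
rewrite mulmxN mulmxBl -(mulmxA _ Q) QV mulmx0 subr0 mul_scalar_mx mul_mx_scalar addNr.
by rewrite mulmxN mulNmx opprK det_lblock mulrC.
Qed.

Lemma det_bipartite n d (y : F) (M : 'M[F]_(n, d)) :
  \det (y%:M - block_mx 0 M M^T 0) * y ^+ d = y ^+ n * \det ((y ^+ 2)%:M - M^T *m M).
Proof.
have := det_mulmx (block_mx y%:M (- M) (- M^T) y%:M) (block_mx 1%:M M 0 y%:M).
rewrite det_ublock det1 mul1r det_scalar => E.
rewrite scalar_mx_block opp_block_mx add_block_mx !subr0 !add0r -E.
rewrite mulmx_block ?(mulmx1, mulmx0, addr0) mul_scalar_mx mul_mx_scalar scalerN subrr.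
by rewrite det_lblock det_scalar mulNmx -scalar_mxM -expr2 addrC.
Qed.

End BorderedDeterminants.

Lemma map_border (F G : comNzRingType) (h : {rmorphism F -> G}) N m
    (M : 'M[F]_N) (W : 'M[F]_(N, m)) T :
  h (\det (border_mx M W T)) = \det (border_mx (map_mx h M) (map_mx h W) T).
Proof.
have hm : map_mx h (maskmx F T) = maskmx G T.
  by rewrite map_diag_mx; congr diag_mx; apply/rowP=> j; rewrite !mxE rmorph_nat.
rewrite -det_map_mx /border_mx map_block_mx map_mxB map_mxN !map_mxM map_scalar_mx rmorph1.
by rewrite map_trmx hm.
Qed.

(** * Non-vanishing on the upper half-plane *)

Section Types.
Variables (m : nat) (J : finType) (colour : 'I_m -> J).
Implicit Types (T : {set 'I_m}) (t : J -> nat).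

Definition colour_count T (c : J) : nat := #|[set i in T | colour i == c]|.
Definition has_type t T := [forall c, colour_count T c == t c].
Definition incr_type t (c : J) : J -> nat := fun c' => (t c' + (c' == c))%N.

Lemma colour_countU1 T i c : i \notin T ->
  colour_count (i |: T) c = incr_type (colour_count T) (colour i) c.
Proof.
move=> iT; rewrite /colour_count /incr_type -(cardsID [set i]) addnC; congr (_ + _)%N.
  apply: eq_card => j; rewrite !inE; case: eqP => // ->.
  by rewrite (negbTE iT).
case: (c =P colour i) => [->|nc].
  rewrite /= -(cards1 i); apply: eq_card => j; rewrite !inE.
  by case: eqP => [->|]; rewrite ?eqxx ?andbF.
apply: eq_card0 => j; rewrite !inE; case: eqP => [->|]; rewrite ?andbF //=.
by rewrite andbT; apply/eqP => /esym.
Qed.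

Lemma card_colour_count T : #|T| = (\sum_c colour_count T c)%N.
Proof.
rewrite -sum1_card (partition_big colour predT) //=; apply: eq_bigr => c _.
by rewrite sum1dep_card /colour_count; apply: eq_card => i; rewrite !inE.
Qed.

Lemma card_has_type t T : has_type t T -> #|T| = (\sum_c t c)%N.
Proof. by move=> /forallP h; rewrite card_colour_count; apply: eq_bigr => c _; apply/eqP. Qed.

Variables (F : comNzRingType) (N : nat).
Implicit Types (M : 'M[F]_N) (W : 'M[F]_(N, m)).

(** The ring is arbitrary because the sum is used both for polynomials in [y] and at a complex
    point. *)
Definition border_sum M W t T0 : F :=
  \sum_(T : {set 'I_m} | (T0 \subset T) && has_type t T) \det (border_mx M W T).

Lemma eq_border_sum M W t t' T0 : t =1 t' -> border_sum M W t T0 = border_sum M W t' T0.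
Proof.
move=> e; apply: eq_bigl => T; congr (_ && _).
by apply: eq_forallb => c; rewrite e.
Qed.

(** Terms with [i] in [T] do not feel the perturbation; each other term gains [w] times the one for
    [i |: T], and [T |-> i |: T] matches the two index families. *)
Lemma border_sum_rank1 M W t T0 i (w : F) : i \notin T0 ->
  border_sum (M + w *: (col i W *m (col i W)^T)) W t T0 =
  border_sum M W t T0 + w * border_sum M W (incr_type t (colour i)) (i |: T0).
Proof.
move=> iT0; rewrite /border_sum.
have -> : \sum_(T : {set 'I_m} | (i |: T0 \subset T) && has_type (incr_type t (colour i)) T)
    \det (border_mx M W T) =
  \sum_(T : {set 'I_m} | ((T0 \subset T) && has_type t T) && (i \notin T))
    \det (border_mx M W (i |: T)).
  rewrite (reindex_onto (fun T => i |: T) (fun T => T :\ i)) /=; last first.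
    by move=> T /andP[]; rewrite subUset sub1set => /andP[iT _] _; rewrite setD1K.
  apply: eq_bigl => T; case: (boolP (i \in T)) => iT.
    rewrite [RHS]andbF; apply/negbTE; rewrite negb_and; apply/orP; right.
    by apply/eqP => /setP/(_ i); rewrite !inE eqxx iT.
  rewrite andbT setU1K // eqxx andbT subUset sub1set setU11 /=; congr (_ && _).
    apply/subsetP/subsetP => h j jT0; have := h j jT0; rewrite ?inE.
      by case: eqP => // ji; rewrite -ji jT0 in iT0.
    by move->; rewrite orbT.
  by apply: eq_forallb => c; rewrite colour_countU1 // /incr_type eqn_add2r.
rewrite mulr_sumr [in RHS](bigID (fun T => i \notin T)) /= -addrA.
rewrite [in LHS](bigID (fun T => i \notin T)) /= [X in _ = _ + X]addrC addrA -big_split /=.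
congr (_ + _).
  by apply: eq_bigr => T /andP[_ iT]; rewrite det_border_notin.
by apply: eq_bigr => T /andP[_ iT]; rewrite det_border_in // -[_ \in _]negbK.
Qed.

(** Double counting: each [T] is reached once from every index of colour [c] in [T :\: T0]. *)
Lemma border_sum_step M W t T0 c :
  \sum_(i | (i \notin T0) && (colour i == c)) border_sum M W t (i |: T0) =
  (t c - colour_count T0 c)%:R * border_sum M W t T0.
Proof.
rewrite /border_sum (exchange_big_dep (fun T => (T0 \subset T) && has_type t T)) /=; last first.
  by move=> i T _ /andP[]; rewrite subUset => /andP[_ ->].
rewrite mulr_sumr; apply: eq_bigr => T /andP[T0T tT].
rewrite sumr_const mulr_natl; congr (_ *+ _).
have/eqP <- := forallP tT c.
rewrite /colour_count -(cardsDS (A := [set i in T | colour i == c])); last first.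
  by apply/subsetP => i; rewrite !inE => /andP[/(subsetP T0T) -> ->].
apply: eq_card => i; rewrite !inE unfold_in subUset sub1set T0T tT !andbT.
by case: (i \in T0); case: (colour i == c); rewrite ?andbT ?andbF.
Qed.

End Types.

Lemma map_border_sum (F G : comNzRingType) (h : {rmorphism F -> G}) m (J : finType)
    (colour : 'I_m -> J) N (M : 'M[F]_N) (W : 'M[F]_(N, m)) t T0 :
  h (border_sum colour M W t T0) = border_sum colour (map_mx h M) (map_mx h W) t T0.
Proof. by rewrite rmorph_sum; apply: eq_bigr => T _; rewrite map_border. Qed.

(** Linear independence of the columns indexed by [T], phrased through coefficient vectors supported
    on [T] to match the masks. *)
Definition indep (F : fieldType) N m (W : 'M[F]_(N, m)) (T : {set 'I_m}) :=
  forall z : 'rV[F]_m, z *m maskmx F T = z -> z *m W^T = 0 -> z = 0.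

Lemma indepS (F : fieldType) N m (W : 'M[F]_(N, m)) (T T' : {set 'I_m}) :
  T' \subset T -> indep W T -> indep W T'.
Proof.
move=> sT iT z zT' zW; apply: iT => //.
apply/rowP=> j; move/rowP/(_ j): zT'; rewrite !mul_mx_diag !mxE.
case: (boolP (j \in T')) => [/(subsetP sT) ->|_]; rewrite ?mulr1 //.
by rewrite mulr0 => <-; rewrite mul0r.
Qed.

Lemma det_border_indep (F : fieldType) N m (M : 'M[F]_N) (W : 'M[F]_(N, m)) T :
  \det (border_mx M W T) != 0 -> indep W T.
Proof.
move=> d0 z zT zW; apply/eqP; apply: contraNT d0 => z0.
apply/det0P; exists (row_mx 0 z).
  by apply: contraNneq z0 => /eqP; rewrite row_mx_eq0 => /andP[].
rewrite /border_mx mul_row_block !mul0mx !add0r mulmxN mulmxA zT zW oppr0.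
by rewrite mulmxBr mulmx1 zT subrr row_mx0.
Qed.

Lemma indep_exists (F : fieldType) n m (B : 'M[F]_(n, m)) k : (k <= \rank B)%N ->
  exists2 S : {set 'I_m}, #|S| = k & indep B S.
Proof.
rewrite -mxrank_tr => kB; pose f := maxrankfun B^T.
pose K := [set j : 'I_(\rank B^T) | (j < k)%N].
exists (f @: K).
  rewrite card_imset; last exact: maxrankfun_inj.
  rewrite cardsE -sum1_card -(big_ord_widen _ (fun=> 1%N) kB) sum1_card card_ord //.
apply: (@indepS _ _ _ _ (f @: setT)); first by rewrite imsetS // subsetT.
move=> z zT zB; pose z' := colsub f z.
have z0 i : i \notin f @: setT -> z 0 i = 0.
  by move=> iT; move/rowP/(_ i): zT; rewrite mul_mx_diag !mxE (negbTE iT) mulr0.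
have z'E : z' *m rowsub f B^T = z *m B^T.
  apply/rowP => j; rewrite !mxE [RHS](bigID (fun i => i \in f @: setT)) /=.
  rewrite [X in _ + X]big1 ?addr0; last by move=> i /z0 ->; rewrite mul0r.
  rewrite big_imset /=; last by move=> a b _ _; apply: maxrankfun_inj.
  by apply: eq_big => [a|a _]; rewrite ?inE // !mxE.
have : z' == 0 by rewrite -(mul_mx_rowfree_eq0 _ (maxrowsub_free _)) z'E zB.
move/eqP => z'0; apply/rowP => i; rewrite mxE.
have [/imsetP[a _ ->]|/z0 //] := boolP (i \in f @: setT).
by move/rowP/(_ a): z'0; rewrite !mxE.
Qed.

(** * Matrices with positive definite imaginary part *)

Section NonVanishing.
Variable R : rcfType.
Local Notation C := R[i].
Notation Im := complex.Im.
Notation Re := complex.Re.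

Lemma Im_add (x y : C) : Im (x + y) = Im x + Im y.
Proof. by case: x y => [a b] [c d]. Qed.

Lemma Im_sum (I : Type) (r : seq I) (P : pred I) (f : I -> C) :
  Im (\sum_(i <- r | P i) f i) = \sum_(i <- r | P i) Im (f i).
Proof. by elim/big_rec2: _ => // i x y _ <-; rewrite Im_add. Qed.

Lemma Im_mulJ (x w : C) : Im (w * (x * conjc x)) = Im w * (Re x ^+ 2 + Im x ^+ 2).
Proof.
by case: x w => [a b] [c d]; simpc; rewrite /= -!expr2 [b * a]mulrC addNr mulr0 add0r.
Qed.

Lemma Im_conj0 (x : C) : conjc x = x -> Im x = 0.
Proof.
case: x => [a b] [] /eqP; rewrite eq_sym -addr_eq0 -mulr2n mulrn_eq0 /=.
by move/eqP.
Qed.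

(** Otherwise [w = - g / f] has nonnegative imaginary part and makes [g + w * f] vanish. *)
Lemma Im_div_lt0 (f g : C) : (forall w, 0 <= Im w -> g + w * f != 0) ->
  f != 0 -> Im (f / g) < 0.
Proof.
move=> h f0; rewrite ltNge; apply/negP => le0.
have g0 : g != 0 by have := h 0; rewrite mul0r addr0; apply; rewrite /=.
have z0 : f / g != 0 by rewrite mulf_neq0 // invr_eq0.
have hw : 0 <= Im (- (f / g)^-1).
  move: (f / g) le0 z0 => [a b] /= b0 _.
  by rewrite ?mulNr opprK divr_ge0 // addr_ge0 // sqr_ge0.
by have := h _ hw; rewrite invf_div mulNr divfK // subrr eqxx.
Qed.

Variable N : nat.
Definition hform (M : 'M[C]_N) (x : 'rV[C]_N) : C :=
  (x *m M *m (map_mx conjc x)^T) 0 0.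
Definition dissipative (M : 'M[C]_N) := forall x, x != 0 -> 0 < Im (hform M x).

Lemma hformD M M' x : hform (M + M') x = hform M x + hform M' x.
Proof. by rewrite /hform mulmxDr mulmxDl mxE. Qed.

Lemma hform_scalar y x : hform y%:M x = y * \sum_j x 0 j * conjc (x 0 j).
Proof.
rewrite /hform mul_mx_scalar -scalemxAl !mxE; congr (_ * _).
by apply: eq_bigr => j _; rewrite !mxE.
Qed.

Lemma hform_real (Z : 'M[C]_N) x : Z^T = Z -> map_mx conjc Z = Z -> Im (hform Z x) = 0.
Proof.
move=> Zs Zr; apply: Im_conj0; rewrite /hform.
have mxJ (A : 'M[C]_1) : conjc (A 0 0) = (map_mx conjc A)^T 0 0 by rewrite !mxE.
rewrite mxJ !map_mxM /= Zr -map_trmx trmx_mul trmxK trmx_mul Zs -map_mx_comp.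
rewrite mulmxA; congr ((_ *m _ *m _) 0 0).
by apply/matrixP => i j; rewrite !mxE /= conjcK.
Qed.

Lemma dissipative_pencil (Z : 'M[C]_N) y : 0 < Im y ->
  Z^T = Z -> map_mx conjc Z = Z -> dissipative (y%:M - Z).
Proof.
move=> y0 Zs Zr x x0; rewrite hformD Im_add.
have -> : Im (hform (- Z) x) = 0.
  by apply: hform_real; rewrite ?map_mxN ?Zr // raddfN /= Zs.
rewrite addr0 hform_scalar.
rewrite mulr_sumr Im_sum.
have [j xj] : exists j, x 0 j != 0 by apply/rV0Pn.
rewrite (bigD1 j) //= ltr_pwDl //.
  rewrite Im_mulJ mulr_gt0 // lt0r addr_ge0 ?sqr_ge0 // andbT.
  by rewrite paddr_eq0 ?sqr_ge0 // !sqrf_eq0; move: xj; rewrite eq_complex.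
by apply: sumr_ge0 => l _; rewrite Im_mulJ mulr_ge0 ?addr_ge0 ?sqr_ge0 // ltW.
Qed.

Lemma dissipative_rank1 M (v : 'cV[C]_N) w : map_mx conjc v = v -> 0 <= Im w ->
  dissipative M -> dissipative (M + w *: (v *m v^T)).
Proof.
move=> vr w0 dM x x0; rewrite hformD Im_add ltr_pwDl ?dM //.
have -> : hform (w *: (v *m v^T)) x = w * ((x *m v) 0 0 * conjc ((x *m v) 0 0)).
  have mxJ (A : 'M[C]_1) : conjc (A 0 0) = (map_mx conjc A)^T 0 0 by rewrite !mxE.
  rewrite /hform mxJ map_mxM vr trmx_mul -scalemxAr -scalemxAl mxE; congr (_ * _).
  by rewrite mulmxA -(mulmxA (x *m v)) [LHS]mxE big_ord1.
by rewrite Im_mulJ mulr_ge0 // addr_ge0 ?sqr_ge0.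
Qed.

Variables (m : nat) (W : 'M[C]_(N, m)).
Hypothesis W_real : map_mx conjc W = W.

(** Pair a left kernel vector [(x, z)] with the conjugate of [x]. Since [W] is real and [x]
    annihilates its columns in [T], this gives [hform M x = 0], so [x = 0]; independence then gives
    [z = 0]. *)
Lemma det_border_neq0 M T : dissipative M -> indep W T ->
  \det (border_mx M W T) != 0.
Proof.
move=> dM iT; apply/det0P => -[v v0].
rewrite -[v]hsubmxK in v0 *; set x := lsubmx v in v0 *; set z := rsubmx v in v0 *.
rewrite /border_mx mul_row_block -[X in _ = X]row_mx0 => /eq_row_mx[E1 E2].
have zD : z *m maskmx _ T = z.
  apply/eqP; rewrite eq_sym -subr_eq0 -{1}[z]mulmx1 -mulmxBr.
  have : (x *m (W *m maskmx C T) + z *m (1%:M - maskmx C T)) *m (1%:M - maskmx C T) = 0.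
    by rewrite E2 mul0mx.
  have DD : maskmx C T *m (1%:M - maskmx C T) = 0.
    by rewrite mulmxBr mulmx1 mask_idem subrr.
  rewrite mulmxDl -!mulmxA DD !mulmx0 add0r.
  by rewrite [(_ - _) *m _]mulmxBl mul1mx DD subr0 => ->.
have xW : x *m W *m maskmx C T = 0.
  by move: E2; rewrite mulmxBr mulmx1 zD subrr addr0 mulmxA.
have x0 : x = 0.
  apply/eqP; apply: contraT => x0; have := dM x x0.
  suff -> : hform M x = 0 by rewrite ltxx.
  have : x *m M = z *m (maskmx C T *m W^T).
    by apply/eqP; rewrite -subr_eq0 -mulmxN; apply/eqP.
  rewrite /hform => ->.
  have : map_mx conjc (x *m W *m maskmx C T) = 0 by rewrite xW map_mx0.
  rewrite !map_mxM W_real /=.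
  have -> : map_mx conjc (maskmx C T) = maskmx C T.
    by rewrite map_diag_mx; congr diag_mx; apply/rowP=> j; rewrite !mxE rmorph_nat.
  move/(congr1 trmx); rewrite !trmx_mul tr_mask trmx0 => e.
  by rewrite -!mulmxA e mulmx0 mxE.
have z0 : z = 0.
  by apply: iT => //; move: E1; rewrite x0 mul0mx add0r mulmxN mulmxA zD => /eqP;
     rewrite oppr_eq0 => /eqP.
by move: v0; rewrite x0 z0 row_mx0 eqxx.
Qed.

Variables (J : finType) (colour : 'I_m -> J).

(* With [g] the sum for one column less of some colour, each [Im (f_i / g) <= 0] by
   [Im_div_lt0], with a strict inequality for one [i]; so [sum_i f_i], a multiple of the
   required sum, is nonzero. *)
Lemma border_sum_neq0 M t (T0 T : {set 'I_m}) :
  dissipative M -> T0 \subset T -> has_type colour t T ->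
  indep W T -> border_sum colour M W t T0 != 0.
Proof.
move=> + sT; have [k] := ubnP #|T :\: T0|.
elim: k M t T0 T sT => // k IH M t T0 T sT; rewrite ltnS => leTk dM tT iT.
have [T0E|] := eqVneq (T :\: T0) set0.
  have TE : T = T0 by apply/eqP; rewrite eqEsubset sT andbT -setD_eq0 T0E.
  rewrite /border_sum (bigD1 T) /=; last by rewrite sT.
  rewrite big1 ?addr0; first exact: det_border_neq0.
  move=> T' /andP[/andP[sT' tT'] nTT']; case/eqP: nTT'; apply/esym/eqP.
  by rewrite eqEcard TE sT' -TE (card_has_type tT') (card_has_type tT) leqnn.
case/set0Pn => i0; rewrite inE => /andP[i0T0 i0T]; pose c := colour i0.
pose T' := T :\ i0; pose t' := colour_count colour T'.
have tE : t =1 incr_type t' c.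
  move=> c'; have/eqP <- := forallP tT c'.
  by rewrite -{1}(setD1K i0T) colour_countU1 // !inE eqxx.
have sT' : T0 \subset T'.
  apply/subsetP => j jT0; rewrite !inE (subsetP sT) // andbT.
  by apply: contraNneq i0T0 => <-.
(* The measure [#|T :\: T0|] drops in both uses of the induction hypothesis: for [g] because [i0]
   leaves [T], for [f i0] because [i0] joins [T0]. *)
have cardT' : (#|T' :\: T0| < k)%N.
  apply: leq_trans leTk; apply: proper_card; apply/properP; split.
    by rewrite setSD // subD1set.
  by exists i0; rewrite !inE ?i0T0 ?i0T // eqxx andbF.
have tT' : has_type colour t' T' by apply/forallP => c'.
have iT' : indep W T' by apply: indepS iT; rewrite subD1set.
pose f i := border_sum colour M W t (i |: T0); pose g := border_sum colour M W t' T0.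
have gf i w : i \notin T0 -> colour i == c -> 0 <= Im w -> g + w * f i != 0.
  move=> iT0 /eqP ic w0.
  have -> : f i = border_sum colour M W (incr_type t' (colour i)) (i |: T0).
    by apply: eq_border_sum => c'; rewrite ic tE.
  rewrite -border_sum_rank1 //; apply: (IH _ _ _ T') => //.
  by apply: dissipative_rank1 => //; rewrite map_col W_real.
have f0 : f i0 != 0.
  apply: (IH _ _ _ T) => //; first by rewrite subUset sub1set i0T.
  apply: leq_trans leTk; apply: proper_card; apply/properP; split.
    by rewrite setDS // subsetUr.
  by exists i0; rewrite !inE ?i0T0 ?i0T // eqxx.
have flt i : i \notin T0 -> colour i == c -> Im (f i / g) <= 0.
  move=> iT0 ic; have [->|fi0] := eqVneq (f i) 0; first by rewrite mul0r.
  by apply/ltW/Im_div_lt0 => // w w0; apply: gf.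
have S : Im (\sum_(i | (i \notin T0) && (colour i == c)) f i / g) < 0.
  rewrite Im_sum (bigD1 i0) /=; last by rewrite i0T0 eqxx.
  rewrite -[ltRHS]addr0 ltr_leD //.
    by apply: Im_div_lt0 => // w w0; apply: gf.
  by apply: sumr_le0 => i /andP[/andP[iT0 ic] _]; apply: flt.
apply: contraTneq S => F0.
by rewrite -mulr_suml border_sum_step F0 mulr0 mul0r ltxx.
Qed.

End NonVanishing.

(** * Interlacing *)

Section Cone.
Variable R : rcfType.
Local Notation C := R[i].
Local Notation Im := complex.Im.
Local Notation Re := complex.Re.
Local Notation rc := (real_complex R).
Local Notation cpoly := (map_poly rc).
Implicit Types f g q : {poly R}.

Lemma conjc_horner f (y : C) : conjc ((cpoly f).[y]) = (cpoly f).[conjc y].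
Proof.
rewrite -horner_map -map_poly_comp; congr (_.[_]).
by apply: eq_map_poly => x; apply: conjc_real.
Qed.

Lemma Re_add (x y : C) : Re (x + y) = Re x + Re y.
Proof. by case: x y => [a b] [c d]. Qed.

Lemma Re_sum (I : Type) (r : seq I) (P : pred I) (F : I -> C) :
  Re (\sum_(i <- r | P i) F i) = \sum_(i <- r | P i) Re (F i).
Proof. by elim/big_rec2: _ => // i x y _ <-; rewrite Re_add. Qed.

Lemma Re_mulr (x : C) (a : R) : Re (x * rc a) = Re x * a.
Proof. by case: x => b c; rewrite /= mulr0 subr0. Qed.

Lemma conjc_lin (l e : R) (om : C) : conjc (rc l + rc e * om) = rc l + rc e * conjc om.
Proof. by case: om => a b; simpc. Qed.

(** For real [e] the conjugate of [q] at [l + e om] is [q] at [l + e conj(om)], so the product is a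
    polynomial in [e]. Its real part is a real polynomial, continuous at 0. *)
Lemma limit_ge0 f q (l : R) (om : C) :
  (forall e, 0 < e ->
     0 <= Re ((cpoly f).[rc l + rc e * om] * conjc ((cpoly q).[rc l + rc e * om]))) ->
  0 <= f.[l] * q.[l].
Proof.
move=> h.
pose P := ((cpoly f) \Po ((rc l)%:P + om *: 'X)) * ((cpoly q) \Po ((rc l)%:P + conjc om *: 'X)).
pose H := \poly_(i < size P) Re P`_i.
have HE e : H.[e] = Re P.[rc e].
  rewrite horner_poly horner_coef Re_sum; apply: eq_bigr => i _.
  by rewrite -rmorphXn Re_mulr.
have PE e : P.[rc e] = (cpoly f).[rc l + rc e * om] * conjc ((cpoly q).[rc l + rc e * om]).
  rewrite conjc_horner hornerM !horner_comp !hornerE; congr (_.[_] * _.[_]).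
    by rewrite mulrC.
  by rewrite conjc_lin mulrC.
have H0 : H.[0] = f.[l] * q.[l].
  rewrite HE PE !mul0r !addr0 conjc_horner conjc_real !horner_map -rmorphM.
  by [].
rewrite -H0 leNgt; apply/negP => lt0.
have [|d d0 hd] := @poly_cont _ 0 H (- H.[0]); first by rewrite oppr_gt0.
have : `|H.[d / 2] - H.[0]| < - H.[0].
  by apply: hd; rewrite subr0 ger0_norm; lra.
have := h (d / 2); rewrite -PE -HE => hh.
rewrite ltr_norml => /andP[_]; have := hh ltac:(lra); lra.
Qed.

(** The principal root has nonnegative imaginary part for [m > 1], and it is not real because its
    power is not. *)
Lemma root_of_i (m : nat) (s : bool) : (m > 1)%N ->
  exists2 om : C, 0 < Im om & om ^+ m = (-1) ^+ s * 'i%C.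
Proof.
move=> m1; pose z : C := (-1) ^+ s * 'i%C; exists (m.-root z); last first.
  by rewrite rootCK // ltnW.
have ge0 : 0 <= Im (m.-root z) by have := Im_rootC_ge0 z m1; rewrite -complexIm ler0c.
rewrite lt0r ge0 andbT; apply/eqP => Im0.
have := rootCK (ltnW m1) z; move: (m.-root z) Im0 => [a b] /= ->.
rewrite complexr0 -rmorphXn => /(congr1 (@complex.Im R)) /=.
by rewrite /z; clear; case: s; rewrite ?expr1 ?expr0 ?mulN1r ?mul1r /= => /eqP;
  rewrite eq_sym ?oppr_eq0 oner_eq0.
Qed.

(* [f / g] maps the open upper half-plane to the closed lower one. *)
Definition pick f g := forall y : C, 0 < Im y -> Im ((cpoly f).[y] * conjc ((cpoly g).[y])) <= 0.

(* Approach [l] along [l + e om]: there the power of [y - l] contributes the sign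
   [(-1)^s].  For [m > 1] both signs are available, for [m = 1] only [s = false]. *)
Lemma pick_local f q (l : R) (m : nat) (s : bool) (om : C) :
  0 < Im om -> om ^+ m = (-1) ^+ s * 'i%C ->
  pick f (q * ('X - l%:P) ^+ m) -> 0 <= (-1) ^+ s * (f.[l] * q.[l]).
Proof.
move=> om0 omE pk; suff : 0 <= ((-1) ^+ s *: f).[l] * q.[l] by rewrite hornerZ mulrA.
apply: (@limit_ge0 _ _ _ om) => e e0.
set y := rc l + rc e * om.
have y0 : 0 < Im y.
  by rewrite /y; case: (om) om0 => a b /= b0; rewrite mul0r addr0 add0r mulr_gt0.
have := pk y y0; rewrite rmorphM rmorphXn rmorphB /= map_polyX map_polyC /=.
rewrite hornerM horner_exp !hornerE /=.
have -> : y - rc l = rc e * om by rewrite /y addrC addKr.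
rewrite exprMn omE -rmorphXn map_polyZ hornerZ.
have : 0 < e ^+ m by apply: exprn_gt0.
move: (e ^+ m) ((cpoly f).[y]) ((cpoly q).[y]) => E [a b] [c d] E0.
clear -E0; case: s; rewrite ?expr1 ?expr0 ?mulN1r ?mul1r; simpc => /= h.
all: rewrite -(pmulr_rge0 _ E0).
all: lra.
Qed.

(** The poles of [f / g] are simple with positive residue: at a multiple pole both signs in
    [pick_local] would force [f.[l] * q.[l] = 0]. *)
Lemma pick_simple f q (l : R) (m : nat) : f.[l] != 0 -> q.[l] != 0 -> (0 < m)%N ->
  pick f (q * ('X - l%:P) ^+ m) -> m = 1%N /\ 0 < f.[l] * q.[l].
Proof.
move=> f0 q0 m0 pk; have fq0 : f.[l] * q.[l] != 0 by rewrite mulf_neq0.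
have [m1|m1] := leqP m 1.
  have mE : m = 1%N by apply/eqP; rewrite eqn_leq m1.
  split=> //; rewrite lt0r fq0 /=.
  have := @pick_local f q l m false 'i%C; rewrite mE expr1 expr0 !mul1r; apply=> //.
  by rewrite -mE.
have [om om0 omE] := root_of_i false m1.
have [om' om0' omE'] := root_of_i true m1.
have := pick_local om0 omE pk; have := pick_local om0' omE' pk.
rewrite expr1 expr0 mul1r mulN1r oppr_ge0 => h1 h2.
by case/eqP: fq0; apply/eqP; rewrite eq_le h1 h2.
Qed.

Section Decomposition.
Variables (n : nat) (l : 'I_n -> R).
Implicit Types A : {set 'I_n}.

Definition rprod A := \prod_(j in A) ('X - (l j)%:P).

Lemma size_rprod A : size (rprod A) = #|A|.+1.
Proof.
by rewrite /rprod -big_enum size_prod_XsubC -cardE.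
Qed.

Lemma rprodD1 A j : j \in A -> rprod A = ('X - (l j)%:P) * rprod (A :\ j).
Proof. by move=> jA; rewrite /rprod (big_setD1 j). Qed.

(** Partial fractions of [f / rprod A]. Roots shared with [f] are divided out by induction; without
    them all roots are simple by [key], and the coefficients are residues, positive by
    [pick_simple]. *)
Lemma pick_cone A f : pick f (rprod A) -> (size f <= #|A|)%N ->
  exists c : 'I_n -> R, (forall j, 0 <= c j) /\
    f = \sum_(j in A) c j *: rprod (A :\ j).
Proof.
have [k] := ubnP #|A|; elim: k A f => // k IH A f; rewrite ltnS => Ak pk sf.
have [/existsP[j0 /andP[j0A /eqP fj0]]|] := boolP [exists j in A, f.[l j] == 0].
  have /factor_theorem[f1 fE] : root f (l j0) by apply/eqP.
  have cA : #|A| = #|A :\ j0|.+1 by rewrite (cardsD1 j0) j0A.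
  have [|||c [c0 f1E]] := IH (A :\ j0) f1.
  - by rewrite -cA.
  - move=> y y0; have := pk y y0; rewrite (rprodD1 j0A) fE !rmorphM /=.
    rewrite rmorphB /= map_polyX map_polyC /= !hornerM !hornerE rmorphM /=.
    move: ((cpoly f1).[y]) ((cpoly (rprod (A :\ j0))).[y]) => a b.
    have -> : a * (y - rc (l j0)) * (conjc (y - rc (l j0)) * conjc b) =
       a * conjc b * ((y - rc (l j0)) * conjc (y - rc (l j0))) by ring.
    rewrite Im_mulJ pmulr_lle0 //; case: y y0 {pk} => u v /= v0.
    by rewrite ltr_wpDl ?sqr_ge0 // subr0 exprn_gt0.
  - have [f10|f10] := eqVneq f1 0; first by rewrite f10 size_poly0.
    by move: sf; rewrite fE size_Mmonic ?monicXsubC // size_XsubC addn2 /= cA.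
  (* A cancelled root is no pole, so its residue is 0. *)
  exists (fun j => if j == j0 then 0 else c j); split.
    by move=> j; case: eqP.
  rewrite (big_setD1 j0) //= eqxx scale0r add0r fE f1E mulr_suml.
  apply: eq_bigr => j; rewrite !inE => /andP[jj0 jA]; rewrite (negbTE jj0).
  rewrite -scalerAl mulrC; congr (_ *: _).
  by rewrite (@rprodD1 (A :\ j) j0) ?setDDl ?[[set j] :|: _]setUC ?inE // eq_sym jj0.
rewrite negb_exists => /forallP fn0.
have fA j : j \in A -> f.[l j] != 0 by move=> jA; have := fn0 j; rewrite jA.
have key j : j \in A -> 0 < f.[l j] * (rprod (A :\ j)).[l j].
  move=> jA; have [m [q qj gE]] := multiplicity_XsubC (rprod A) (l j).
  have g0 : rprod A != 0 by rewrite -size_poly_gt0 size_rprod.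
  rewrite g0 /= in qj; have gj : root (rprod A) (l j).
    by rewrite (rprodD1 jA) rootM root_XsubC eqxx.
  have m0 : (0 < m)%N.
    by rewrite lt0n; apply: contraTneq gj => m0; rewrite gE m0 expr0 mulr1.
  rewrite gE in pk; have [m1 lt0] := pick_simple (fA j jA) qj m0 pk.
  suff -> : rprod (A :\ j) = q by [].
  apply: (mulfI (negbT (polyXsubC_eq0 (l j)))).
  by rewrite -rprodD1 // gE m1 expr1 mulrC.
have dist : {in A &, injective l}.
  move=> i j iA jA lij; apply/eqP; apply: contraT => nij.
  have jAi : j \in A :\ i by rewrite !inE eq_sym nij.
  by have := key i iA; rewrite (rprodD1 jAi) hornerM hornerXsubC lij subrr mul0r mulr0 ltxx.
(* [(rprod (A :\ j)).[l j]] is the derivative of [rprod A] at [l j], so this quotient is the residue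
   there. *)
exists (fun j => if j \in A then f.[l j] / (rprod (A :\ j)).[l j] else 0); split.
  move=> j; case: ifP => // jA.
  have := key j jA; set b := (_.[l j] in X in _ < _ * X) => fb.
  have b0 : b != 0 by apply: contraTneq fb => ->; rewrite mulr0 ltxx.
  have -> : f.[l j] / b = f.[l j] * b / b ^+ 2 by field.
  by rewrite divr_ge0 // ?sqr_ge0 // ltW.
apply/eqP; rewrite -subr_eq0; apply/eqP.
(* The difference has size at most [#|A|] and vanishes at the [#|A|] distinct points [l j]. *)
apply: (@roots_geq_poly_eq0 _ _ [seq l j | j <- enum A]).
- apply/allP => x /mapP[j]; rewrite mem_enum => jA ->.
  rewrite /root hornerD hornerN horner_sum (big_setD1 j) //= jA hornerZ big1.
    rewrite addr0 divfK ?subrr //.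
    by apply: contraTneq (key j jA) => ->; rewrite mulr0 ltxx.
  move=> i; rewrite !inE => /andP[ij iA]; rewrite hornerZ.
  have jAi : j \in A :\ i by rewrite !inE eq_sym ij.
  apply/eqP; rewrite mulf_eq0; apply/orP; right.
  by rewrite (rprodD1 jAi) hornerM hornerXsubC subrr mul0r.
- rewrite map_inj_in_uniq ?enum_uniq // => i j; rewrite !mem_enum; exact: dist.
rewrite size_map -cardE (leq_trans (size_polyD _ _)) // geq_max sf size_polyN.
apply: (leq_trans (size_sum _ _ _)); apply/bigmax_leqP => j jA.
rewrite (leq_trans (size_scale_leq _ _)) // size_rprod.
by rewrite [X in (_ <= X)%N](cardsD1 j) jA.
Qed.

End Decomposition.
End Cone.

(** * From a common interlacer to one good summand *)

Section Step.
Variable R : rcfType.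
Local Notation C := R[i].
Local Notation Im := complex.Im.
Local Notation rc := (real_complex R).
Local Notation cpoly := (map_poly rc).
Implicit Types f g : {poly R}.

(** Roots of a real polynomial are closed under conjugation, so a non-real one would yield one in
    the upper half-plane. *)
Lemma real_rooted g : (forall y : C, 0 < Im y -> (cpoly g).[y] != 0) ->
  exists n (l : 'I_n -> R), size g = n.+1 /\ g = lead_coef g *: rprod l setT.
Proof.
move=> g0; have [rs gE] := closed_field_poly_normal (cpoly g).
have g_neq0 : g != 0.
  by apply/eqP => gz; have := g0 'i%C ltr01; rewrite gz rmorph0 horner0 eqxx.
have lg : lead_coef (cpoly g) = rc (lead_coef g) by rewrite lead_coef_map.
have Im0 z : z \in rs -> Im z = 0.
  move=> zrs; have zr : (cpoly g).[z] = 0.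
    rewrite gE hornerZ (big_rem z) //= hornerM hornerXsubC subrr mul0r mulr0 //.
  apply/eqP; rewrite eq_le; apply/andP; split; rewrite leNgt; apply/negP => Iz.
    by have := g0 z Iz; rewrite zr eqxx.
  have := g0 (conjc z); rewrite -conjc_horner zr conjc0 eqxx => h.
  by have := h ltac:(by case: (z) Iz => a b /=; rewrite oppr_gt0).
have gE' : g = lead_coef g *: \prod_(r <- map (@complex.Re R) rs) ('X - r%:P).
  apply: (map_poly_inj rc); rewrite map_polyZ rmorph_prod /= big_map {1}gE lg.
  congr (_ *: _); rewrite big_seq [RHS]big_seq; apply: eq_bigr => z /Im0.
  by case: z => a b /= ->; rewrite map_polyXsubC.
exists (size rs), (fun j => (map (@complex.Re R) rs)`_j); split.
  by rewrite gE' size_scale ?lead_coef_eq0 // size_prod_XsubC size_map.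
rewrite {1}gE' /rprod; congr (_ *: _).
rewrite (big_nth 0) size_map big_mkord; apply: eq_bigl => j; rewrite inE //.
Qed.

Lemma rprod_gt0 n (l : 'I_n -> R) (A : {set 'I_n}) x :
  (forall j, j \in A -> l j < x) -> 0 < (rprod l A).[x].
Proof.
by move=> h; rewrite horner_prod; apply: prodr_gt0 => j /h; rewrite hornerXsubC subr_gt0.
Qed.

(** If every [F i] failed to be positive somewhere beyond [b], take the least [x] of the failure
    points. Beyond [b] a nonpositive value of [F i] forces nonpositive values to its left, so all
    [F i] are nonpositive at [x], against the positivity of their sum. *)
Lemma positive_step (I : finType) (P : pred I) (F : I -> {poly R}) g b :
  (forall i y w, P i -> 0 < Im y -> 0 <= Im w ->
     (cpoly g).[y] + w * (cpoly (F i)).[y] != 0) ->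
  0 < lead_coef g -> (forall i, P i -> (size (F i) < size g)%N) ->
  (forall x, b < x -> 0 < (\sum_(i | P i) F i).[x]) ->
  exists2 i, P i & forall x, b < x -> 0 < (F i).[x].
Proof.
move=> gF lg szF pos.
have [i0 Pi0] : exists i, P i.
  apply: contrapT => nP; have := pos (b + 1) ltac:(lra).
  by rewrite big1 ?horner0 ?ltxx // => i Pi; case: nP; exists i.
have g0 y : 0 < Im y -> (cpoly g).[y] != 0.
  by move=> y0; have := gF i0 y 0 Pi0 y0 (lexx _); rewrite mul0r addr0.
have [n [l [sg gE]]] := real_rooted g0.
have /fin_all_exists[c cP] : forall i, exists c, P i ->
    (forall j, 0 <= c j) /\ F i = \sum_(j in [set: _]) c j *: rprod l (setT :\ j).
  move=> i; have [Pi|] := boolP (P i); last by exists (fun=> 0).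
  have [||c hc] := @pick_cone _ _ l setT (F i); last by exists c.
    move=> y y0; have := g0 y y0.
    have := @Im_div_lt0 _ (cpoly (F i)).[y] (cpoly g).[y] ltac:(by move=> w; apply: gF).
    rewrite {1 2}gE map_polyZ hornerZ; set p := (cpoly (rprod _ _)).[y].
    set f := (cpoly (F i)).[y] => h gn0.
    have [->|f0] := eqVneq f 0; first by rewrite mul0r.
    have a0 : rc (lead_coef g) != 0 by move: gn0; rewrite mulf_eq0 negb_or => /andP[].
    have p0 : p != 0 by move: gn0; rewrite mulf_eq0 negb_or => /andP[].
    have -> : f * conjc p = f / (rc (lead_coef g) * p) * (p * conjc p) * rc (lead_coef g).
      by field; rewrite a0 p0.
    have ImZ (z : C) (a : R) : Im (z * rc a) = Im z * a.
      by case: z => u v; rewrite /= mulr0 add0r.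
    rewrite ImZ Im_mulJ; apply: mulr_le0_ge0; last exact: ltW.
    by apply: mulr_le0_ge0; rewrite ?addr_ge0 ?sqr_ge0 // ltW // h.
  by rewrite cardsT card_ord -ltnS -sg szF.
apply: contrapT => nex.
have /fin_all_exists[xs xsP] : forall i, exists x, P i -> b < x /\ (F i).[x] <= 0.
  move=> i; have [Pi|] := boolP (P i); last by exists 0.
  apply: contrapT => /forallNP h; apply: nex; exists i => // x bx.
  by rewrite ltNge; apply/negP => le0; apply: (h x).
have [i1 Pi1 i1min] := arg_minP xs Pi0.
have [bx1 _] := xsP _ Pi1; set x := xs i1 in bx1 i1min.
suff Fle0 i : P i -> (F i).[x] <= 0.
  have := pos x bx1; rewrite ltNge horner_sum => /negP; apply.
  by apply: sumr_le0.
move=> Pi; have [bxi Fxi] := xsP i Pi; have xxi := i1min i Pi.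
have [c0 FE] := cP i Pi.
(* [l j0] is the largest root of [g]. If [g] has no root, every [F i] is an empty sum. *)
have [j0 j0max|no_j] := pickP (fun j0 => [forall j, l j <= l j0]); last first.
  clear sg gE cP c0; case: n l c no_j FE => [l c _ ->|n l c no_j _].
    by rewrite big1 ?horner0 // => -[].
  have [j _ jmax] := @arg_maxP _ _ _ ord0 predT l isT.
  by have := no_j j; rewrite (introT forallP) // => k; apply: jmax.
(* All [F i] are nonpositive at the second largest root of [g], hence it is at most [b]. *)
have le_b j : j != j0 -> l j <= b.
  move=> jj0; have [j1 j1j0 j1max] := @arg_maxP _ _ _ j (fun j => j != j0) l jj0.
  apply: (le_trans (j1max j jj0)); rewrite leNgt; apply/negP => /pos.
  rewrite ltNge horner_sum => /negP; apply; apply: sumr_le0 => k Pk.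
  have [ck FkE] := cP k Pk; rewrite FkE horner_sum; apply: sumr_le0 => s _.
  rewrite hornerZ mulr_ge0_le0 //.
  have [->|sj1] := eqVneq s j1; last first.
    have j1s : j1 \in setT :\ s by rewrite !inE eq_sym sj1.
    by rewrite (rprodD1 _ j1s) hornerM hornerXsubC subrr mul0r.
  have j0j1 : j0 \in setT :\ j1 by rewrite !inE eq_sym j1j0.
  rewrite (rprodD1 _ j0j1) hornerM hornerXsubC mulr_le0_ge0 //.
    by rewrite subr_le0; apply: (forallP j0max).
  rewrite horner_prod; apply: prodr_ge0 => u; rewrite !inE => /and3P[uj0 _ _].
  by rewrite hornerXsubC subr_ge0; apply: j1max.
(* [F i / h] is nondecreasing on the half-line above [b]. *)
pose h := rprod l (setT :\ j0).
have h_gt0 z : b < z -> 0 < h.[z].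
  by move=> bz; apply: rprod_gt0 => j; rewrite !inE andbT => /le_b /le_lt_trans; apply.
rewrite -(pmulr_lle0 _ (h_gt0 _ bxi)).
suff le : (F i).[x] * h.[xs i] <= (F i).[xs i] * h.[x].
  by apply: (le_trans le); rewrite mulr_le0_ge0 // ltW // h_gt0.
rewrite FE !horner_sum !mulr_suml; apply: ler_sum => j _; rewrite !hornerZ -!mulrA.
apply: ler_wpM2l; first exact: c0.
have [->|jj0] := eqVneq j j0; first by rewrite mulrC.
have j0j : j0 \in setT :\ j by rewrite !inE eq_sym jj0.
have jj0' : j \in setT :\ j0 by rewrite !inE jj0.
rewrite /h (rprodD1 _ j0j) (rprodD1 _ jj0') !hornerM !hornerXsubC.
have -> : setT :\ j0 :\ j = setT :\ j :\ j0 by rewrite !setDDl setUC.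
have r_gt0 z : b < z -> 0 < (rprod l (setT :\ j :\ j0)).[z].
  move=> bz; apply: rprod_gt0 => u; rewrite !inE => /and3P[uj0 _ _].
  exact: le_lt_trans (le_b _ uj0) bz.
have r1 := r_gt0 _ bx1; have r2 := r_gt0 _ bxi; move: r1 r2.
move: (_.[x]) (_.[xs i]) => r1 r2 r1_gt0 r2_gt0.
have lj : l j <= l j0 by apply: (forallP j0max).
rewrite -subr_ge0.
have -> : (xs i - l j0) * r2 * ((x - l j) * r1) - (x - l j0) * r1 * ((xs i - l j) * r2)
  = r1 * r2 * ((xs i - x) * (l j0 - l j)) by ring.
by rewrite !mulr_ge0 ?subr_ge0 // ltW.
Qed.

End Step.

(** * Greedy selection *)

Lemma horner_char_poly (F : comNzRingType) n (A : 'M[F]_n) s :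
  (char_poly A).[s] = \det (s%:M - A).
Proof.
rewrite -[LHS]/(horner_eval s _) -det_map_mx; congr (\det _).
apply/matrixP => i j; rewrite !mxE /= /horner_eval.
by rewrite hornerD hornerN hornerMn hornerX hornerC.
Qed.

(** * Gram matrices and existence of the pseudoinverse *)

Section RealGram.
Variable R : realType.

Lemma rv_norm_eq0 n (v : 'rV[R]_n) : (v *m v^T == 0) = (v == 0).
Proof.
apply/eqP/eqP => [|->]; last by rewrite mul0mx.
move/matrixP/(_ 0 0); rewrite !mxE => /eqP; rewrite psumr_eq0; last first.
  by move=> j _; rewrite mxE -expr2 sqr_ge0.
move=> /allP h; apply/rowP => j; apply/eqP.
by have := h j (mem_index_enum j); rewrite !mxE -expr2 sqrf_eq0.
Qed.

Lemma gram_unit m n (H : 'M[R]_(m, n)) : row_free H -> H *m H^T \in unitmx.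
Proof.
move=> Hf; rewrite unitmxE unitfE; apply/det0P => -[v v0 vH].
case/eqP: v0; apply/eqP; rewrite -(mul_mx_rowfree_eq0 v Hf) -rv_norm_eq0.
by rewrite trmx_mul mulmxA -(mulmxA v) vH mul0mx.
Qed.

(** The classical formula for the pseudoinverse of a full-rank factorization. *)
Lemma penrose_exists m k n (G : 'M[R]_(m, k)) (H : 'M[R]_(k, n)) :
  row_free G^T -> row_free H -> exists X, penrose (G *m H) X.
Proof.
move=> fG fH; have uH := gram_unit fH.
have uG : G^T *m G \in unitmx by rewrite -{2}[G]trmxK; apply: gram_unit.
exists (H^T *m invmx (H *m H^T) *m invmx (G^T *m G) *m G^T).
set X := _ *m G^T.
have MX : G *m H *m X = G *m invmx (G^T *m G) *m G^T.
  by rewrite /X !mulmxA -(mulmxA G) mulmxK.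
have XM : X *m (G *m H) = H^T *m invmx (H *m H^T) *m H.
  by rewrite /X !mulmxA -(mulmxA _ G^T) mulmxKV.
split.
- by rewrite MX -!mulmxA (mulmxA G^T) mulKmx.
- by rewrite XM /X !mulmxA -(mulmxA _ H) mulmxKV.
- by rewrite MX !trmx_mul trmxK trmx_inv trmx_mul trmxK mulmxA.
- by rewrite XM !trmx_mul trmxK trmx_inv trmx_mul trmxK mulmxA.
Qed.

(** Shows that the epsilon choice in [pinv] is not vacuous; everything later about [pinv] comes from
    these conditions. *)
Lemma penrose_pinv m n (M : 'M[R]_(m, n)) : penrose M (pinv M).
Proof.
rewrite /pinv; apply: ClassicalEpsilon.epsilon_spec.
have := @penrose_exists _ _ _ (col_base M) (row_base M).
rewrite mulmx_base; apply; last exact: row_base_free.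
by rewrite /row_free mxrank_tr; apply: col_base_full.
Qed.

Lemma lead_gt0_large (p : {poly R}) : 0 < lead_coef p ->
  exists x0, forall x, x0 <= x -> 0 < p.[x].
Proof.
by move=> lp; have [x0 h] := poly_pinfty_gt_lc lp; exists x0 => x /h; apply: lt_le_trans.
Qed.

(** A negative determinant would give [det (s + V^T V)] a zero at some [s > 0] by the intermediate
    value theorem. A kernel vector [v] then makes the sum of [s |v|^2] and a squared norm vanish, so
    [v = 0]. *)
Lemma gram_det_ge0 m n (V : 'M[R]_(m, n)) : 0 <= \det (V^T *m V).
Proof.
rewrite leNgt; apply/negP => lt0; pose p := char_poly (- (V^T *m V)).
have pE s : p.[s] = \det (s%:M + V^T *m V) by rewrite horner_char_poly opprK.
have [x0 hx0] := @lead_gt0_large p ltac:(by rewrite (monicP (char_poly_monic _)) ltr01).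
have [||s s01 /rootP ps] := @polyrcf.poly_ivt _ p 0 (Num.max 0 x0).
- by rewrite le_max lexx.
- rewrite mulr_le0_ge0 // ?pE ?raddf0 ?add0r; first exact: ltW.
  by rewrite -pE ltW // hx0 // le_max lexx orbT.
have s0 : 0 <= s by move: s01; rewrite itv_boundlr => /andP[].
have sn0 : s != 0.
  apply: contraTneq lt0 => s00; rewrite -leNgt.
  by move: ps; rewrite s00 pE raddf0 add0r => ->.
move: ps; rewrite pE => /eqP/det0P[v v0 ev].
have : (v *m (s%:M + V^T *m V) *m v^T) 0 0 = 0 by rewrite ev mul0mx mxE.
rewrite mulmxDr mulmxDl mul_mx_scalar -scalemxAl mulmxA -mulmxA.
have -> : V *m v^T = (v *m V^T)^T by rewrite trmx_mul trmxK.
have nn k (u : 'rV[R]_k) : 0 <= (u *m u^T) 0 0.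
  by rewrite mxE sumr_ge0 // => j _; rewrite mxE -expr2 sqr_ge0.
rewrite mxE [X in X + _]mxE => /eqP; rewrite paddr_eq0 ?mulr_ge0 ?nn //.
rewrite mulf_eq0 (negbTE sn0) /= => /andP[/eqP e _].
case/eqP: v0; apply/eqP; rewrite -rv_norm_eq0; apply/eqP/matrixP => i j.
by rewrite !ord1 e mxE.
Qed.

End RealGram.

(** * Adding columns one at a time *)

Section Chain.
Variable R : realType.
Local Notation C := R[i].
Local Notation Im := complex.Im.
Local Notation rc := (real_complex R).
Local Notation cpoly := (map_poly rc).

Variables (N m : nat) (J : finType) (colour : 'I_m -> J).
Variables (Z : 'M[R]_N) (W : 'M[R]_(N, m)).
Hypothesis Zsym : Z^T = Z.
Local Notation WP := (map_mx polyC W).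
Local Notation bpoly T := (\det (border_mx (char_poly_mx Z) WP T)).
Local Notation fpoly := (border_sum colour (char_poly_mx Z) WP).

Lemma border_polyE t T (E : 'M[R]_(m, t)) (X : 'M[R]_(t, N)) Q :
  E^T *m E = 1%:M -> E *m E^T = maskmx R T -> Q = 1%:M - (W *m E) *m X ->
  (W *m E *m X)^T = W *m E *m X -> W *m E *m X *m (W *m E) = W *m E ->
  bpoly T * 'X^t = \det ((W *m E)^T *m (W *m E)) *: char_poly (Q *m Z *m Q).
Proof.
move=> E1 E2 QE s1 s2.
have hm : map_mx polyC (maskmx R T) = maskmx {poly R} T.
  by rewrite map_diag_mx; congr diag_mx; apply/rowP=> j; rewrite !mxE rmorph_nat.
rewrite (@det_border_select _ _ _ _ _ _ _ (map_mx polyC E)); last 2 first.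
- by rewrite map_trmx -map_mxM E1 map_scalar_mx.
- by rewrite map_trmx -map_mxM E2 hm.
rewrite -map_mxM (@det_border_proj _ _ _ _ _ (map_mx polyC Q) _ (map_mx polyC X)).
- by rewrite map_trmx -!map_mxM det_map_mx mul_polyC.
- by rewrite QE map_mxB map_scalar_mx /= polyC1 map_mxM.
- by rewrite -map_mxM map_trmx s1.
- by rewrite -!map_mxM s2.
Qed.

(** Times a power of ['X], the polynomial is a nonnegative Gram determinant times a monic
    characteristic polynomial. *)
Lemma border_poly_lead (T : {set 'I_m}) : bpoly T != 0 ->
  [/\ (size (bpoly T) + #|T|)%N = N.+1 & 0 < lead_coef (bpoly T)].
Proof.
move=> p0; have [X1 _ X2 _] := penrose_pinv (W *m selmx R T).
have := border_polyE (selmx_orth _ T) (selmx_mask _ T) (erefl _) X2 X1.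
set a := \det (_^T *m _) => e.
have a0 : a != 0.
  apply: contraNneq p0 => a0; move/eqP: e; rewrite a0 scale0r.
  by rewrite mulf_eq0 (negbTE (monic_neq0 (monicXn _ _))) orbF.
split.
  have := congr1 (@size _ \o @polyseq _) e; rewrite /= size_scale // size_char_poly.
  by rewrite size_mulXn // addnC.
have := congr1 lead_coef e; rewrite lead_coef_Mmonic ?monicXn // => ->.
by rewrite lead_coefZ (monicP (char_poly_monic _)) mulr1 lt0r a0 gram_det_ge0.
Qed.

Lemma fpoly_size t T0 : (size (fpoly t T0) <= N.+1 - \sum_c t c)%N.
Proof.
apply: (leq_trans (size_sum _ _ _)); apply/bigmax_leqP => T /andP[_ /card_has_type <-].
have [->|p0] := eqVneq (bpoly T) 0; first by rewrite size_poly0.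
by have [<- _] := border_poly_lead p0; rewrite addnK.
Qed.

(** All nonzero terms have the same degree and positive leading coefficients, so nothing cancels. *)
Lemma fpoly_lead t (T0 T : {set 'I_m}) : T0 \subset T -> has_type colour t T -> bpoly T != 0 ->
  (size (fpoly t T0) + \sum_c t c)%N = N.+1 /\ 0 < lead_coef (fpoly t T0).
Proof.
move=> sT tT p0; have [sz lead] := border_poly_lead p0; pose s := (\sum_c t c)%N.
have cT : #|T| = s := card_has_type tT.
have sN : (s <= N)%N.
  by rewrite -ltnS -sz cT -[X in (X < _)%N]add0n ltn_add2r size_poly_gt0.
have coef_gt0 T' : has_type colour t T' -> bpoly T' != 0 -> 0 < (bpoly T')`_(N - s).
  move=> /card_has_type cT' q0; have [sz' lead'] := border_poly_lead q0.
  suff -> : (N - s)%N = (size (bpoly T')).-1 by rewrite -lead_coefE.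
  by have -> : size (bpoly T') = (N.+1 - s)%N by [rewrite -sz' cT' addnK]; rewrite subSn.
have pos : 0 < (fpoly t T0)`_(N - s).
  rewrite coef_sum (bigD1 T) ?sT //= ltr_pwDl ?coef_gt0 //.
  apply: sumr_ge0 => T' /andP[/andP[_ tT'] _].
  by have [->|q0] := eqVneq (bpoly T') 0; rewrite ?coef0 // ltW // coef_gt0.
have szE : size (fpoly t T0) = (N - s).+1.
  apply/eqP; rewrite eqn_leq -subSn // fpoly_size /= subSn //.
  rewrite ltnNge; apply/negP => /leq_sizeP/(_ _ (leqnn _)) e.
  by rewrite e ltxx in pos.
by rewrite lead_coefE szE /= addSn subnK.
Qed.

Let ev (y : C) : {rmorphism {poly R} -> C} := horner_eval y \o cpoly.

Let eval_char y : map_mx (ev y) (char_poly_mx Z) = y%:M - map_mx rc Z.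
Proof.
apply/matrixP => i j; rewrite !mxE /= /horner_eval.
by rewrite rmorphB rmorphMn /= map_polyX map_polyC hornerD hornerN hornerMn hornerX hornerC.
Qed.

Let ev_W y : map_mx (ev y) WP = map_mx rc W.
Proof. by apply/matrixP => i j; rewrite !mxE /= /horner_eval map_polyC hornerC. Qed.

Lemma fpoly_eval t T0 (y : C) :
  (cpoly (fpoly t T0)).[y] =
  border_sum colour (y%:M - map_mx rc Z) (map_mx rc W) t T0.
Proof. by rewrite -eval_char -(ev_W y) -map_border_sum. Qed.

Lemma bpoly_eval T (y : C) :
  (cpoly (bpoly T)).[y] =
  \det (border_mx (y%:M - map_mx rc Z) (map_mx rc W) T).
Proof. by rewrite -eval_char -(ev_W y) -map_border. Qed.

Let Wr : map_mx conjc (map_mx rc W) = map_mx rc W.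
Proof. by apply/matrixP => i j; rewrite !mxE conjc_real. Qed.

Lemma dissipative_real (y : C) : 0 < Im y -> dissipative (y%:M - map_mx rc Z).
Proof.
move=> y0; apply: dissipative_pencil => //; first by rewrite map_trmx Zsym.
by apply/matrixP => i j; rewrite !mxE conjc_real.
Qed.

(** One direction evaluates at the Cauchy bound, which is no root of a nonzero polynomial; the other
    evaluates at ['i], where the pencil is dissipative. *)
Lemma bpoly_neq0_indep T : bpoly T != 0 <-> indep (map_mx rc W) T.
Proof.
split=> [p0|iT].
  pose x := rc (cauchy_bound (bpoly T)).
  apply: (@det_border_indep _ _ _ (x%:M - map_mx rc Z)); rewrite -bpoly_eval horner_map.
  rewrite fmorph_eq0; have := ge_cauchy_bound p0; apply.
  by rewrite in_itv /= lexx.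
apply/eqP => p0.
have := det_border_neq0 Wr (@dissipative_real 'i%C ltr01) iT.
by rewrite -bpoly_eval p0 rmorph0 horner0 eqxx.
Qed.

Lemma fpoly_neq0 t (T0 T : {set 'I_m}) (y : C) : T0 \subset T -> has_type colour t T ->
  indep (map_mx rc W) T -> 0 < Im y -> (cpoly (fpoly t T0)).[y] != 0.
Proof.
move=> sT tT iT y0; rewrite fpoly_eval; apply: border_sum_neq0 sT tT iT => //.
exact: dissipative_real.
Qed.

(** Each round applies [positive_step] to the sums over [i |: T0], with one column less of the
    colour of [i] in [g]. The positivity hypothesis passes to the enlarged set, so the indices are
    found iteratively. *)
Lemma greedy_chain t T0 b : (forall x, b < x -> 0 < (fpoly t T0).[x]) ->
  exists T : {set 'I_m},
    [/\ T0 \subset T, has_type colour t T & forall x, b < x -> 0 < (bpoly T).[x]].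
Proof.
have [k] := ubnP (\sum_c t c - #|T0|)%N; elim: k T0 => // k IH T0.
rewrite ltnS => lek pos.
(* A positive sum has a nonzero term, so [T0] extends to an independent set of the prescribed
   type. *)
have [T /andP[sT tT] p0] : exists2 T : {set 'I_m},
    (T0 \subset T) && has_type colour t T & bpoly T != 0.
  apply: contrapT => nT; have := pos (b + 1) ltac:(lra).
  rewrite /border_sum big1 ?horner0 ?ltxx // => T hT.
  by apply/eqP; apply: contraT => pT; case: nT; exists T.
have [T0E|] := eqVneq (T :\: T0) set0.
  have TE : T = T0 by apply/eqP; rewrite eqEsubset sT andbT -setD_eq0 T0E.
  subst T0; exists T; rewrite subxx; split=> // x bx; have := pos x bx.
  rewrite /border_sum (bigD1 T) /=; last by rewrite sT.
  rewrite big1 ?addr0 //.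
  move=> T' /andP[/andP[sT' tT'] nTT']; case/eqP: nTT'; apply/esym/eqP.
  by rewrite eqEcard sT' (card_has_type tT') (card_has_type tT) leqnn.
case/set0Pn => i0; rewrite inE => /andP[i0T0 i0T]; pose c := colour i0.
pose T' := T :\ i0; pose t' := colour_count colour T'.
have i0T' : i0 \notin T' by rewrite !inE eqxx.
have tE : t =1 incr_type t' c.
  move=> c'; have/eqP <- := forallP tT c'.
  by rewrite -{1}(setD1K i0T) colour_countU1.
have sT' : T0 \subset T'.
  apply/subsetP => j jT0; rewrite !inE (subsetP sT) // andbT.
  by apply: contraNneq i0T0 => <-.
have tT' : has_type colour t' T' by apply/forallP => c'.
have iT : indep (map_mx rc W) T by apply/bpoly_neq0_indep.
have iT' : indep (map_mx rc W) T' by apply: indepS iT; rewrite subD1set.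
have [szg lg] := fpoly_lead sT' tT' ((bpoly_neq0_indep T').2 iT').
have sumE : (\sum_c t c = (\sum_c t' c).+1)%N.
  by rewrite -(card_has_type tT) -(card_has_type tT') (cardsD1 i0) i0T.
have [||||i /andP[iT0 /eqP ic] posi] := @positive_step R _
    (fun i => (i \notin T0) && (colour i == c)) (fun i => fpoly t (i |: T0))
    (fpoly t' T0) b => //.
- move=> i y w /andP[iT0 /eqP ic] y0 w0.
  have -> : fpoly t (i |: T0) = fpoly (incr_type t' (colour i)) (i |: T0).
    by apply: eq_border_sum => c'; rewrite ic tE.
  rewrite !fpoly_eval -border_sum_rank1 //; apply: border_sum_neq0 sT' tT' iT' => //.
  apply: dissipative_rank1 => //; last exact: dissipative_real.
  by rewrite map_col Wr.
- move=> i _; apply: (leq_ltn_trans (fpoly_size _ _)).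
  rewrite sumE -szg subnS addnK prednK ?leqnn // size_poly_gt0 -lead_coef_eq0.
  by rewrite gt_eqF.
(* The counting factor is positive: [T] contains [T0] and also [i0], of colour [c]. *)
- move=> x bx; rewrite border_sum_step -polyC_natr mul_polyC hornerZ mulr_gt0 ?pos //.
  rewrite ltr0n subn_gt0 tE /incr_type eqxx addn1 ltnS; apply: subset_leq_card.
  by apply/subsetP => j; rewrite !inE => /andP[/(subsetP sT')]; rewrite !inE => ->.
have [|T1 [sT1 tT1 pos1]] := IH (i |: T0) _ posi.
  rewrite cardsU1 iT0 add1n subnS (leq_trans _ lek) // ltn_predL subn_gt0 sumE ltnS.
  by rewrite -(card_has_type tT') subset_leq_card.
exists T1; split=> //; apply: subset_trans sT1; exact: subsetUr.
Qed.

End Chain.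

(** * The bipartite pencil *)

Section PairSets.
Variables p q : nat.
Implicit Types (S : {set 'I_p}) (Rs : {set 'I_q}) (T : {set 'I_(p + q)}).

Definition side (i : 'I_(p + q)) : bool := if split i is inl _ then true else false.

Definition pairset S Rs : {set 'I_(p + q)} :=
  [set i | match split i with inl j => j \in S | inr j => j \in Rs end].

Lemma split_l j : split (lshift q j : 'I_(p + q)) = inl j.
Proof. exact: (unsplitK (inl j)). Qed.

Lemma split_r j : split (rshift p j : 'I_(p + q)) = inr j.
Proof. exact: (unsplitK (inr j)). Qed.

Lemma colour_count_pairset S Rs c :
  colour_count side (pairset S Rs) c = if c then #|S| else #|Rs|.
Proof.
rewrite /colour_count; case: c.
  rewrite -(card_imset _ (@lshift_inj p q)); apply: eq_card => i.
  rewrite !inE /side; case: (split_ordP i) => j ->.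
    by rewrite andbT mem_imset //; apply: lshift_inj.
  rewrite andbF; apply/esym/negbTE/imsetP => -[k _ /eqP].
  by rewrite eq_sym eq_lrshift.
rewrite -(card_imset _ (@rshift_inj p q)); apply: eq_card => i.
rewrite !inE /side; case: (split_ordP i) => j ->.
  rewrite andbF; apply/esym/negbTE/imsetP => -[k _ /eqP].
  by rewrite eq_lrshift.
by rewrite andbT mem_imset //; apply: rshift_inj.
Qed.

(* [true] counts the columns of [B], [false] the rows of [C]. *)
Definition twotype (k r : nat) (c : bool) := if c then k else r.

Lemma has_type_pairset S Rs k r :
  has_type side (twotype k r) (pairset S Rs) = (#|Rs| == r) && (#|S| == k).
Proof.
apply/forallP/andP => [h|[/eqP hr /eqP hk] c].
  by have := h true; have := h false; rewrite !colour_count_pairset.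
by rewrite colour_count_pairset /twotype; case: c; rewrite ?hr ?hk.
Qed.

Lemma big_pairset (F : nmodType) (f : {set 'I_(p + q)} -> F) k r :
  \sum_(T : {set 'I_(p + q)} | has_type side (twotype k r) T) f T =
  \sum_(Rs : {set 'I_q} | #|Rs| == r) \sum_(S : {set 'I_p} | #|S| == k) f (pairset S Rs).
Proof.
rewrite pair_big /= (reindex (fun x : {set 'I_q} * {set 'I_p} => pairset x.2 x.1)) /=.
  by apply: eq_bigl => x; rewrite has_type_pairset.
exists (fun T => ([set j | rshift p j \in T], [set j | lshift q j \in T])) => [[Rs S] _|T _] /=.
  by congr (_, _); apply/setP => j; rewrite !inE ?split_l ?split_r.
by apply/setP => i; rewrite !inE; case: (split_ordP i) => j ->; rewrite inE.
Qed.

End PairSets.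

(** * Identification of the bordered determinants with [pSR] and [Pkr] *)

Section Assembly.
Variable R : realType.
Variables (n d dB nC : nat) (A : 'M[R]_(n, d)) (B : 'M[R]_(n, dB)) (C : 'M[R]_(nC, d)).
Implicit Types (S : {set 'I_dB}) (Rs : {set 'I_nC}).
Local Notation rc := (real_complex R).

Definition bipartite_mx : 'M[R]_(n + d) := block_mx 0 A A^T 0.
Definition direction_mx : 'M[R]_(n + d, dB + nC) := block_mx B 0 0 C^T.

Lemma bipartite_sym : bipartite_mx^T = bipartite_mx.
Proof. by rewrite /bipartite_mx tr_block_mx !trmx0 trmxK. Qed.

Lemma colSE S : colS B S = B *m selmx R S.
Proof.
apply/matrixP => i j; rewrite !mxE (bigD1 (enum_val j)) //= big1 ?addr0.
  by rewrite !mxE eqxx mulr1.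
by move=> k kj; rewrite !mxE (negbTE kj) mulr0.
Qed.

Lemma rowSE Rs : (rowS C Rs)^T = C^T *m selmx R Rs.
Proof.
apply/matrixP => i j; rewrite !mxE (bigD1 (enum_val j)) //= big1 ?addr0.
  by rewrite !mxE eqxx mulr1.
by move=> k kj; rewrite !mxE (negbTE kj) mulr0.
Qed.

Lemma mask_pairset S Rs : maskmx R (pairset S Rs) = block_mx (maskmx R S) 0 0 (maskmx R Rs).
Proof.
apply/matrixP => i j; rewrite !mxE inE.
case: (split_ordP i) => i' ->; rewrite !mxE ?split_l ?split_r;
  case: (split_ordP j) => j' ->; rewrite !mxE ?split_l ?split_r.
all: by rewrite ?eq_lshift ?eq_rshift ?eq_lrshift ?[rshift _ _ == _]eq_sym ?eq_lrshift ?mulr0n.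
Qed.

Lemma char_poly_bipartite (M : 'M[R]_(n, d)) :
  char_poly (block_mx 0 M M^T 0) * 'X^d = 'X^n * (char_poly (M^T *m M) \Po 'X^2).
Proof.
have -> : char_poly (M^T *m M) \Po 'X^2 =
    \det (('X^2)%:M - (map_mx polyC M)^T *m map_mx polyC M).
  rewrite -[LHS]/(comp_poly 'X^2 _) -det_map_mx map_trmx -map_mxM; congr (\det _).
  by apply/matrixP => i j; rewrite !mxE /= comp_polyB comp_polyC rmorphMn /= comp_polyX.
rewrite -det_bipartite; congr (\det _ * _).
by rewrite /char_poly_mx map_block_mx !map_mx0 map_trmx.
Qed.

Lemma Qproj_sym S : (Qproj B S)^T = Qproj B S.
Proof.
have [_ _ h _] := penrose_pinv (colS B S).
by rewrite /Qproj linearB /= trmx1 h.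
Qed.

Lemma Pproj_sym Rs : (Pproj C Rs)^T = Pproj C Rs.
Proof.
have [_ _ _ h] := penrose_pinv (rowS C Rs).
by rewrite /Pproj linearB /= trmx1 h.
Qed.

Local Notation bpoly T :=
  (\det (border_mx (char_poly_mx bipartite_mx) (map_mx polyC direction_mx) T)).

(** The selected columns [V] are block diagonal, hence so is the projection [Q] onto the complement
    of their range, and it compresses [A] to [Q_S A P_R]. The transposed pseudoinverse of [C_R]
    serves for [C_R^T]. *)
Lemma bpoly_pSR S Rs :
  bpoly (pairset S Rs) * 'X^(#|S| + #|Rs|) * 'X^d =
  (\det (rowS C Rs *m (rowS C Rs)^T) * \det ((colS B S)^T *m colS B S)) *:
    ('X^n * (pSR A B C S Rs \Po 'X^2)).
Proof.
pose E := block_mx (selmx R S) 0 0 (selmx R Rs).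
pose V := block_mx (colS B S) 0 0 (rowS C Rs)^T.
pose X := block_mx (pinv (colS B S)) 0 0 (pinv (rowS C Rs))^T.
pose Q := block_mx (Qproj B S) 0 0 (Pproj C Rs).
have VE : direction_mx *m E = V.
  by rewrite mulmx_block ?(mulmx0, mul0mx, addr0, add0r) -colSE -rowSE.
have [b1 _ b3 _] := penrose_pinv (colS B S).
have [c1 _ _ c4] := penrose_pinv (rowS C Rs).
have VX : V *m X = block_mx (colS B S *m pinv (colS B S)) 0 0 (pinv (rowS C Rs) *m rowS C Rs).
  by rewrite mulmx_block ?(mulmx0, mul0mx, addr0, add0r) -trmx_mul c4.
rewrite (@border_polyE _ _ _ _ direction_mx _ _ E X Q); first last.
- rewrite VE VX mulmx_block ?(mulmx0, mul0mx, addr0, add0r) b1; congr block_mx.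
  by rewrite -{1}c4 -trmx_mul mulmxA c1.
- by rewrite VE VX tr_block_mx !trmx0 b3 c4.
- by rewrite VE VX scalar_mx_block opp_block_mx add_block_mx !oppr0 !addr0.
- rewrite mask_pairset tr_block_mx !trmx0 mulmx_block ?(mulmx0, mul0mx, addr0, add0r).
  by rewrite !selmx_mask.
- rewrite tr_block_mx !trmx0 mulmx_block ?(mulmx0, mul0mx, addr0, add0r).
  by rewrite !selmx_orth -scalar_mx_block.
rewrite -scalerAl VE; congr (_ *: _).
  rewrite tr_block_mx !trmx0 mulmx_block ?(mulmx0, mul0mx, addr0, add0r).
  by rewrite det_lblock trmxK mulrC.
rewrite -char_poly_bipartite; congr (char_poly _ * _).
rewrite !mulmx_block ?(mulmx0, mul0mx, addr0, add0r).
by rewrite !trmx_mul Qproj_sym Pproj_sym mulmxA.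
Qed.

Variables k r : nat.
Local Notation fpoly :=
  (border_sum (@side dB nC) (char_poly_mx bipartite_mx) (map_mx polyC direction_mx) (twotype k r)).

Lemma fpoly_Pkr :
  fpoly set0 * 'X^(k + r + d) = 'X^n * (Pkr k r A B C \Po 'X^2).
Proof.
rewrite /border_sum.
have -> : \sum_(T : {set 'I_(dB + nC)} |
    (set0 \subset T) && has_type (@side dB nC) (twotype k r) T)
  bpoly T = \sum_(T : {set 'I_(dB + nC)} | has_type (@side dB nC) (twotype k r) T) bpoly T.
  by apply: eq_bigl => T; rewrite sub0set.
rewrite big_pairset /Pkr rmorph_sum mulr_suml mulr_sumr /=.
apply: eq_bigr => Rs /eqP <-; rewrite rmorph_sum mulr_suml mulr_sumr.
apply: eq_bigr => S /eqP <-.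
by rewrite exprD mulrA bpoly_pSR /= comp_polyZ scalerAr.
Qed.

Lemma indep_pairset S Rs : indep (map_mx rc B) S -> indep (map_mx rc C^T) Rs ->
  indep (map_mx rc direction_mx) (pairset S Rs).
Proof.
move=> iS iR z; rewrite -[z]hsubmxK; set z1 := lsubmx z; set z2 := rsubmx z.
have -> : maskmx _ (pairset S Rs) = map_mx rc (maskmx R (pairset S Rs)).
  by rewrite map_diag_mx; congr diag_mx; apply/rowP=> j; rewrite !mxE rmorph_nat.
rewrite mask_pairset map_trmx tr_block_mx !map_block_mx !trmx0 !map_mx0 !mul_row_block.
rewrite ?(mulmx0, addr0, add0r) => /eq_row_mx[e1 e2].
rewrite -[RHS](row_mx0 _ 1 n d) => /eq_row_mx[e3 e4].
have mE p (T : {set 'I_p}) : maskmx (complex R) T = map_mx rc (maskmx R T).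
  by rewrite map_diag_mx; congr diag_mx; apply/rowP=> j; rewrite !mxE rmorph_nat.
have -> : z1 = 0 by apply: iS; rewrite ?mE // map_trmx.
have -> : z2 = 0 by apply: iR; rewrite ?mE // map_trmx.
by rewrite row_mx0.
Qed.

End Assembly.

(** * Spectral norm and largest root *)

Lemma gram_rank (F : fieldType) n t (V : 'M[F]_(n, t)) :
  \det (V^T *m V) != 0 -> \rank V = t.
Proof.
move=> d0; apply/eqP; rewrite eqn_leq rank_leq_col /=.
have u : V^T *m V \in unitmx by rewrite unitmxE unitfE.
by rewrite -{1}(mxrank_unit u) mxrankM_maxr.
Qed.

Lemma rayleigh_le (C : numClosedFieldType) n (A : 'M[C]_n) (b : C) (x : 'rV[C]_n) :
  A \is hermsymmx -> (forall a, a \is Num.real -> eigenvalue A a -> a <= b) ->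
  (x *m A *m (map_mx Num.conj x)^T) 0 0 <= b * (x *m (map_mx Num.conj x)^T) 0 0.
Proof.
move=> Ah ev; set P := spectralmx A; set sp := spectral_diag A.
have AE : A = invmx P *m diag_mx sp *m P.
  by apply/orthomx_spectralP; apply: hermitian_normalmx.
have Pu : P \in unitmx by apply: spectral_unit.
have PV : invmx P = map_mx Num.conj P^T.
  by rewrite invmx_unitary ?spectral_unitarymx.
have spr j : sp 0 j \is Num.real by have /mxOverP := hermitian_spectral_diag_real Ah; apply.
have spe j : eigenvalue A (sp 0 j).
  apply/eigenvalueP; exists (row j P).
    rewrite AE !mulmxA -row_mul mulmxV // -row_mul mul1mx row_diag_mx.
    by rewrite -scalemxAl -rowE.
  apply: contraTneq Pu => rj0; rewrite -row_free_unit; apply/negP => Pf.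
  have : (delta_mx 0 j : 'rV[C]_n) *m P == 0 by rewrite -rowE rj0.
  rewrite mul_mx_rowfree_eq0 // => /eqP/matrixP/(_ 0 j); rewrite !mxE !eqxx => /eqP.
  by rewrite oner_eq0.
pose u := x *m invmx P.
have uc : (map_mx Num.conj u)^T = P *m (map_mx Num.conj x)^T.
  rewrite /u map_mxM trmx_mul PV; congr (_ *m _).
  by apply/matrixP => i j; rewrite !mxE; exact: conjCK.
have -> : x *m A *m (map_mx Num.conj x)^T = u *m diag_mx sp *m (map_mx Num.conj u)^T.
  by rewrite uc AE /u !mulmxA.
have -> : x *m (map_mx Num.conj x)^T = u *m (map_mx Num.conj u)^T.
  by rewrite uc /u mulmxA mulmxKV.
rewrite mul_mx_diag !mxE mulr_sumr; apply: ler_sum => j _; rewrite !mxE.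
by rewrite mulrAC [X in X <= _]mulrC ler_wpM2r ?mul_conjC_ge0 ?ev.
Qed.


From mathcomp Require Import classical_sets.

Section Norm.
Variable R : realType.
Local Notation rc := (real_complex R).

Lemma enorm_ge0 m (x : 'cV[R]_m) : 0 <= enorm x.
Proof. exact: sqrtr_ge0. Qed.

Lemma sqr_enorm m (x : 'cV[R]_m) : enorm x ^+ 2 = (x^T *m x) 0 0.
Proof.
rewrite sqr_sqrtr; first by rewrite mxE; apply: eq_bigr => i _; rewrite mxE expr2.
by apply: sumr_ge0 => i _; apply: sqr_ge0.
Qed.

(** The real Gram matrix is viewed as a complex Hermitian one for the spectral theorem; its real
    eigenvalues are roots of the real characteristic polynomial, hence at most [b]. *)
Lemma enorm_mul_le m n (M : 'M[R]_(m, n)) b (x : 'cV[R]_n) :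
  (forall s, b < s -> (char_poly (M^T *m M)).[s] != 0) ->
  enorm (M *m x) ^+ 2 <= b * enorm x ^+ 2.
Proof.
move=> h; pose H := M^T *m M.
have Hs : H^T = H by rewrite trmx_mul trmxK.
have Hh : map_mx rc H \is hermsymmx.
  apply: realsym_hermsym.
    by apply/is_hermitianmxP; rewrite expr0 scale1r map_mx_id // map_trmx Hs.
  by apply/mxOverP => i j; rewrite mxE complex_real.
have := @rayleigh_le _ _ _ (rc b) (map_mx rc x^T) Hh.
have -> : (map_mx Num.conj (map_mx rc x^T))^T = map_mx rc x.
  by apply/matrixP => i j; rewrite !mxE conj_Creal // complex_real.
have rc00 (Y : 'M[R]_1) : (map_mx rc Y) 0 0 = rc (Y 0 0) by rewrite mxE.
rewrite -!map_mxM !rc00 -rmorphM lecR => r.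
rewrite !sqr_enorm trmx_mul mulmxA -(mulmxA x^T); apply: r => a /complex_realP[s ->].
rewrite eigenvalue_root_char -map_char_poly fmorph_root lecR leNgt => /rootP e.
by apply/negP => /h; rewrite e eqxx.
Qed.

Lemma spnorm_le m n (M : 'M[R]_(m, n)) b : 0 <= b ->
  (forall s, b < s -> (char_poly (M^T *m M)).[s] != 0) -> spnorm M ^+ 2 <= b.
Proof.
move=> b0 h; set A := [set enorm (M *m x) | x in [set x : 'cV[R]_n | enorm x = 1]]%classic.
have ub : ubound A (Num.sqrt b).
  move=> _ [x /= x1 <-]; rewrite -(ler_pXn2r (n := 2)) ?nnegrE ?enorm_ge0 ?sqrtr_ge0 //.
  by rewrite [leRHS]sqr_sqrtr // (le_trans (enorm_mul_le _ h)) // x1 expr1n mulr1.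
(* Without unit vectors ([n = 0]) the supremum takes its default value 0, and [0 <= b] suffices. *)
have [A0|/set0P A0] := eqVneq A set0.
  by rewrite /spnorm -/A A0 sup0 expr0n.
have [_ [x x1 _]] := A0; rewrite -[leRHS]sqr_sqrtr // ler_pXn2r ?nnegrE ?sqrtr_ge0 //.
  exact: ge_sup.
apply: le_trans (enorm_ge0 (M *m x)) _; apply: ub_le_sup; last by exists x.
by exists (Num.sqrt b).
Qed.

(** A nonpositive value at [x] would produce a root at or beyond [x]. Roots are bounded by the
    Cauchy bound, so [sup] does bound this root. *)
Lemma maxroot_pos (p : {poly R}) x : 0 < lead_coef p -> maxroot p < x -> 0 < p.[x].
Proof.
move=> lp mx; rewrite ltNge; apply/negP => le0.
have p0 : p != 0 by apply: contraTneq lp => ->; rewrite lead_coef0 ltxx.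
have [x0 hx0] := lead_gt0_large lp.
have [||s s01 ps] := @polyrcf.poly_ivt _ p x (Num.max x x0).
- by rewrite le_max lexx.
- by rewrite mulr_le0_ge0 // ltW // hx0 // le_max lexx orbT.
have xs : x <= s by move: s01; rewrite itv_boundlr => /andP[].
suff : s <= maxroot p by rewrite leNgt (lt_le_trans mx xs).
apply: sup_upper_bound => //; split; first by exists s.
exists (cauchy_bound p) => z /= /rootP pz; rewrite (le_trans (ler_norm z)) // ltW //.
exact: cauchy_boundP.
Qed.
End Norm.

Theorem theorem1p1 (R : realType) (n d dB nC : nat)
  (A : 'M[R]_(n, d)) (B : 'M[R]_(n, dB)) (C : 'M[R]_(nC, d)) (k r : nat) :
  (k <= \rank B)%N -> (r <= \rank C)%N ->
  exists (S : {set 'I_dB}) (Rs : {set 'I_nC}),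
    [/\ #|S| = k, #|Rs| = r, \rank (colS B S) = k, \rank (rowS C Rs) = r &
        spnorm (Qproj B S *m A *m Pproj C Rs) ^+ 2 <= maxroot (Pkr k r A B C)].
Proof.
move=> kB rC; set P := Pkr k r A B C; set be := maxroot P.
pose rc := real_complex R; pose Z := bipartite_mx A; pose W := direction_mx B C.
pose f := border_sum (@side dB nC) (char_poly_mx Z) (map_mx polyC W) (twotype k r) finset.set0.
have fE : f * 'X^(k + r + d) = 'X^n * (P \Po 'X^2) := fpoly_Pkr A B C k r.
have [S0 cS0 iS0] : exists2 S : {set 'I_dB}, #|S| = k & indep (map_mx rc B) S.
  by apply: indep_exists; rewrite mxrank_map.
have [R0 cR0 iR0] : exists2 S : {set 'I_nC}, #|S| = r & indep (map_mx rc C^T) S.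
  by apply: indep_exists; rewrite mxrank_map mxrank_tr.
pose T0 := pairset S0 R0.
have iT0 : indep (map_mx rc W) T0 by apply: indep_pairset.
have tT0 : has_type (@side dB nC) (twotype k r) T0.
  by rewrite has_type_pairset cS0 cR0 !eqxx.
have [_ lf] := fpoly_lead (finset.sub0set T0) tT0
  ((bpoly_neq0_indep W (bipartite_sym A) T0).2 iT0).
have lP : 0 < lead_coef P.
  (* Composition with ['X^2] and factors ['X^j] preserve the leading coefficient. *)
  have := congr1 lead_coef fE; rewrite lead_coef_Mmonic ?monicXn // lead_coef_monicM ?monicXn //.
  rewrite lead_coef_comp ?size_polyXn // lead_coefXn expr1n mulr1 => <-.
  exact: lf.
(* A negative root [x] of [P] would make [f] vanish at [i sqrt (- x)]. *)
have be_ge0 : 0 <= be.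
  rewrite leNgt; apply/negP => be_lt0.
  (* If [P] had no root, [be] would be the default supremum 0. *)
  have [E0|/set0P[x Px]] := eqVneq [set x : R | root P x]%classic set0.
    by move: be_lt0; rewrite /be /maxroot E0 sup0 ltxx.
  have P0 : P != 0 by apply: contraTneq lP => ->; rewrite lead_coef0 ltxx.
  have x_lt0 : x < 0.
    apply: le_lt_trans be_lt0; apply: ub_le_sup => //.
    exists (cauchy_bound P) => z /= /rootP pz; rewrite (le_trans (ler_norm z)) // ltW //.
    exact: cauchy_boundP.
  pose y : R[i] := Complex 0 (Num.sqrt (- x)).
  have y0 : 0 < complex.Im y by rewrite /= sqrtr_gt0 oppr_gt0.
  have y2 : y ^+ 2 = rc x.
    rewrite expr2 /y; simpc; rewrite -expr2 sqr_sqrtr ?opprK //.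
    by rewrite oppr_ge0 ltW.
  have := fpoly_neq0 (bipartite_sym A) (finset.sub0set T0) tT0 iT0 y0.
  have := congr1 (fun p => (map_poly rc p).[y]) fE.
  rewrite !rmorphM /= map_comp_poly !map_polyXn !hornerM horner_comp !hornerXn y2.
  rewrite horner_map (rootP Px) rmorph0 mulr0 => /eqP; rewrite mulf_eq0 expf_eq0.
  have -> : (y == 0) = false by apply/negbTE; apply: contraTneq y0 => ->; rewrite /= ltxx.
  by rewrite andbF orbF => ->.
(* [f] is [P] in the variable [y^2] up to powers of [y], so the threshold for [f] is a square
   root. *)
pose b := Num.sqrt be.
have b2 x : b < x -> 0 < x /\ be < x ^+ 2.
  move=> bx; have x0 : 0 < x by apply: le_lt_trans bx; apply: sqrtr_ge0.
  by split=> //; rewrite -[be]sqr_sqrtr // ltr_pXn2r ?nnegrE ?sqrtr_ge0 // ltW.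
have evE (p q : {poly R}) x u v : 0 < x -> p * 'X^u = 'X^v * q ->
    (0 < p.[x]) = (0 < q.[x]).
  move=> x0 /(congr1 (fun p => p.[x])); rewrite !hornerM !hornerXn => e.
  by rewrite -(pmulr_lgt0 _ (exprn_gt0 u x0)) e pmulr_rgt0 // exprn_gt0.
have fpos x : b < x -> 0 < f.[x].
  move=> /b2[x0 bx]; rewrite (evE _ _ _ _ _ x0 fE) horner_comp hornerXn.
  exact: maxroot_pos.
have [T [_ tT Tpos]] := greedy_chain (bipartite_sym A) fpos.
pose S := [set j | lshift nC j \in T]%SET; pose Rs := [set j | rshift dB j \in T]%SET.
have TE : T = pairset S Rs.
  by apply/setP => i; rewrite !inE; case: (split_ordP i) => j ->; rewrite inE.
move: tT; rewrite TE has_type_pairset => /andP[/eqP cR /eqP cS].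
have bE := bpoly_pSR A B C S Rs; rewrite -TE -mulrA -exprD scalerAr in bE.
have pos x : b < x -> 0 < (\det (rowS C Rs *m (rowS C Rs)^T) * \det ((colS B S)^T *m colS B S))
   * (pSR A B C S Rs).[x ^+ 2].
  move=> bx; have := Tpos x bx; have [x0 _] := b2 x bx.
  by rewrite (evE _ _ _ _ _ x0 bE) hornerZ horner_comp hornerXn.
(* Strict positivity at a single point beyond [b] makes both Gram determinants nonzero, which gives
   the two ranks. *)
have := pos (b + 1) ltac:(lra); rewrite lt0r mulf_eq0 negb_or => /andP[/andP[+ _] _].
rewrite mulf_eq0 negb_or => /andP[dC dB0].
exists S, Rs; split=> //.
- by rewrite gram_rank.
- by rewrite -mxrank_tr gram_rank ?trmxK.
(* Every [s > be] is a square [x ^+ 2] with [x > b], where [pos] excludes a root of [pSR]. *)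
apply: spnorm_le => // s bs; pose x := Num.sqrt s.
have s0 : 0 < s by apply: le_lt_trans bs.
have bx : b < x by rewrite ltr_sqrt.
by have := pos x bx; rewrite sqr_sqrtr ?(ltW s0) // lt0r mulf_eq0 negb_or => /andP[/andP[_ ->]].
Qed.
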